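(* Let $(\mathcal{A},R)$ be a crystallographic arrangement in $V=\mathbb{R}^r$, $M=\sum_{\alpha\in R}\mathbb{Z}\alpha\subseteq V^*$, $N\subseteq V$ the lattice dual to $M$, and $\Sigma=\Sigma_R$ the fan in $N$ consisting of all intersections of closed chambers of $\mathcal{A}$. Let $P$ be the convex polytope in $V^*$ with vertex set $\{\rho^K\mid K\in\mathcal{K}(\mathcal{A})\}$, where $\rho^K=\frac12\sum_{\alpha\in R^K_+}\alpha$. Then the toric variety $X_\Sigma$ is a projective variety isomorphic to $X_P$.
   Context: A simplicial arrangement $\mathcal{A}$ in $V=\mathbb{R}^r$ is a finite set of distinct linear hyperplanes such that every connected component (chamber) of $V\setminus\bigcup_{H\in\mathcal{A}}H$ is an open simplicial cone; $\mathcal{K}(\mathcal{A})$ is the set of chambers. Let $R\subseteq V^*$ be a finite set with $\mathcal{A}=\{\alpha^\perp\mid\alpha\in R\}$ and $\mathbb{R}\alpha\cap R=\{\pm\alpha\}$ for all $\alpha\in R$. For $K\in\mathcal{K}(\mathcal{A})$ let $B^K$ be the set of $\alpha\in R$ such that $\alpha\ge0$ on $K$ and $\dim(\alpha^\perp\cap\overline K)=r-1$, and let $R^K_+=R\cap\sum_{\alpha\in B^K}\mathbb{R}_{\ge0}\alpha$. The pair $(\mathcal{A},R)$ is a crystallographic arrangement if $R\subseteq\sum_{\alpha\in B^K}\mathbb{Z}\alpha$ for all $K\in\mathcal{K}(\mathcal{A})$. Toric varieties are over $\mathbb{C}$. The elements $\rho^K$ lie in $\frac12M$; $X_P$ denotes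 the toric variety (with respect to the lattice $N$) of the normal fan of $P$, equivalently of the lattice polytope $2P$. *)

(* Defs.v *)
From HB Require Import structures.
From mathcomp Require Import all_boot all_order all_algebra.
From mathcomp Require Import complex.
(* mpoly must come before MathComp-Analysis: the notations clash in the other
   order. *)
From mathcomp Require Import mpoly.
From mathcomp Require Import boolp classical_sets cardinality fsbigop reals.
From mathcomp Require Import topology normedtype.

Set Implicit Arguments.
Unset Strict Implicit.
Unset Printing Implicit Defensive.

Import Order.TTheory GRing.Theory Num.Theory numFieldNormedType.Exports.
Local Open Scope classical_set_scope.
Local Open Scope ring_scope.

(* V = R^r is the space of row vectors ['rV[R]_r], and V^* is the space of
   column vectors ['cV[R]_r], acting on V by matrix product. *)
Section Arrangements.
Variables (R : realType) (r : nat).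
Local Notation V := 'rV[R]_r.
Local Notation V' := 'cV[R]_r.
Implicit Types (A : set (set V)) (Phi S : set V') (K : set V).

Definition ev (a : V') (x : V) : R := (x *m a) ord0 ord0.

Definition perp (a : V') : set V := [set x | ev a x = 0].

Definition is_hyperplane (H : set V) : Prop := exists2 a, a != 0 & H = perp a.

Definition complement A : set V := ~` \bigcup_(H in A) H.

Definition chambers A : set (set V) :=
  [set connected_component (complement A) x | x in complement A].

(* The rows of [B] are the generators of the cone. *)
Definition open_simplicial_cone K : Prop :=
  exists2 B : 'M[R]_r, B \in unitmx &
    K = [set x | exists2 c : V, (forall i, 0 < c ord0 i) & x = c *m B].

Record simplicial_arrangement A : Prop := {
  simplicial_finite : finite_set A;
  simplicial_hyperplanes : forall H, A H -> is_hyperplane H;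
  simplicial_chambers : forall K, chambers A K -> open_simplicial_cone K
}.

(* [dim_eq X d]: the linear span of [X] has dimension [d], that is, some [d]
   elements of [X] (the rows of [B]) form a basis of it. *)
Definition dim_eq (X : set V) (d : nat) : Prop :=
  exists2 B : 'M[R]_(d, r), row_free B &
    (forall i, X (row i B)) /\ (forall x, X x -> (x <= B)%MS).

(* The two spans are used for finite [S] only; the sums [\sum_(a \in S)] are
   then honest finite sums. *)
Definition int_span S : set V' :=
  [set b | exists c : V' -> int, b = \sum_(a \in S) a *~ c a].

Definition nonneg_span S : set V' :=
  [set b | exists2 c : V' -> R, (forall a, 0 <= c a)
         & b = \sum_(a \in S) c a *: a].

(* B^K *)
Definition simple_roots Phi K : set V' :=
  [set a | [/\ Phi a, forall x, K x -> 0 <= ev a x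
           & dim_eq (perp a `&` closure K) r.-1]].

(* R^K_+ *)
Definition positive_roots Phi K : set V' :=
  Phi `&` nonneg_span (simple_roots Phi K).

Record crystallographic_arrangement A Phi : Prop := {
  cryst_simplicial : simplicial_arrangement A;
  cryst_finite : finite_set Phi;
  cryst_perp : A = [set perp a | a in Phi];
  cryst_reduced : forall a, Phi a ->
    [set c *: a | c in [set: R]] `&` Phi = [set a; - a];
  cryst_integral : forall K, chambers A K ->
    Phi `<=` int_span (simple_roots Phi K)
}.

(* rho^K *)
Definition rho Phi K : V' := 2^-1 *: \sum_(a \in positive_roots Phi K) a.

(* Sigma_R. The intersections range over nonempty families, so that V itself
   is not a cone of the fan by convention. *)
Definition arrangement_fan A : set (set V) :=
  [set s | exists F : set (set V),
     [/\ F `<=` chambers A, F !=set0 & s = \bigcap_(K in F) closure K]].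

Definition dual_lattice (M : set V') : set V :=
  [set x | forall m, M m -> ev m x \is a Num.int].

(* The lattice in V^* dual to a lattice in V. *)
Definition character_lattice (N : set V) : set V' :=
  [set m | forall x, N x -> ev m x \is a Num.int].

Definition convex_hull S : set V' :=
  [set y | exists n (p : 'I_n -> V') (t : 'I_n -> R),
     [/\ forall i, S (p i), forall i, 0 <= t i, \sum_i t i = 1
       & y = \sum_i t i *: p i]].

(* The face of [P] on which the linear function [x] is minimal. *)
Definition face_of (P : set V') (x : V) : set V' :=
  [set m | P m /\ forall m', P m' -> ev m x <= ev m' x].

Definition is_face (P Q : set V') : Prop :=
  Q !=set0 /\ exists x, Q = face_of P x.

Definition vertices (P : set V') : set V' := [set v | is_face P [set v]].

(* Inner normals, as is usual for toric varieties. *)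
Definition normal_cone (P Q : set V') : set V :=
  [set x | Q `<=` face_of P x].

Definition normal_fan (P : set V') : set (set V) :=
  [set normal_cone P Q | Q in is_face P].

End Arrangements.

(* Varieties in the classical sense, as spaces with functions: a set of points
   with a Zariski topology and, on every open set, a notion of regular C-valued
   function. Functions are total; [regular U f] only concerns the values of [f]
   on [U], and is only meaningful for open [U]. *)
Section Varieties.
Variable C : fieldType.

Record fspace := FSpace {
  points :> Type;
  is_open : set (set points);
  regular : set points -> set (points -> C)
}.

Definition is_morphism (X Y : fspace) (phi : X -> Y) : Prop :=
  forall W : set Y, is_open W ->
    is_open (phi @^-1` W) /\
    forall f : Y -> C, regular W f -> regular (phi @^-1` W) (f \o phi).

Definition isomorphic (X Y : fspace) : Prop :=
  exists (phi : X -> Y) (psi : Y -> X),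
    [/\ is_morphism phi, is_morphism psi, cancel phi psi & cancel psi phi].

(* The affine variety with set of points [T] and coordinate ring [O]: the
   closed sets are the zero loci of subsets of [O], and the regular functions
   are locally quotients of elements of [O]. *)
Definition affine_fspace (T : Type) (O : set (T -> C)) : fspace :=
  @FSpace T
    [set U | exists2 S, S `<=` O & U = [set x | exists2 g, S g & g x != 0]]
    (fun U f => forall x, U x -> exists g h, [/\ O g, O h, h x != 0 &
       forall y, U y -> h y != 0 -> f y = g y / h y]).

(* Gluing of the spaces [U i] along the equivalence relation [e] on their
   disjoint union. A point is an equivalence class. *)
Section Glue.
Variables (I : Type) (U : I -> fspace).
Variable e : {i : I & U i} -> set {i : I & U i}.

Definition glued_points : Type :=
  {c : set {i : I & U i} | exists p, c = e p}.

Definition glue_incl (i : I) (x : U i) : glued_points :=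
  exist _ (e (existT _ i x)) (ex_intro _ _ erefl).

Definition glue : fspace :=
  @FSpace glued_points
    [set W | forall i, is_open (@glue_incl i @^-1` W)]
    (fun W f => forall i, regular (@glue_incl i @^-1` W) (f \o @glue_incl i)).

End Glue.

Section Projective.
Variable n : nat.
Local Notation poly := {mpoly C[n.+1]}.

(* P^n: the lines through the origin of C^(n+1). *)
Definition proj_space := {L : {vspace 'rV[C]_n.+1} | \dim L == 1%N}.

(* [v] is a vector of homogeneous coordinates of [p]. *)
Definition coords (p : proj_space) (v : 'rV[C]_n.+1) : Prop :=
  v != 0 /\ v \in val p.

Definition peval (F : poly) (v : 'rV[C]_n.+1) : C :=
  F.@[fun i => v ord0 i].

Definition proj_closed (Z : set proj_space) : Prop :=
  exists2 S : set poly, (forall F, S F -> exists d, F \is d.-homog) &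
    Z = [set p | forall F v, S F -> coords p v -> peval F v = 0].

Definition proj_irreducible (Z : set proj_space) : Prop :=
  Z !=set0 /\ forall Z1 Z2, proj_closed Z1 -> proj_closed Z2 ->
    Z `<=` Z1 `|` Z2 -> Z `<=` Z1 \/ Z `<=` Z2.

(* Regular functions are locally quotients of homogeneous polynomials of the
   same degree. *)
Definition proj_fspace (Z : set proj_space) : fspace :=
  @FSpace {p : proj_space | Z p}
    [set U | exists2 Y, proj_closed Y & U = [set p | ~ Y (sval p)]]
    (fun U f => forall p, U p -> exists d F G,
       [/\ F \is d.-homog, G \is d.-homog,
           forall v, coords (sval p) v -> peval G v != 0 &
           forall q v, U q -> coords (sval q) v -> peval G v != 0 ->
             f q = peval F v / peval G v]).

End Projective.

Definition projective_variety (X : fspace) : Prop :=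
  exists n (Z : set (proj_space n)),
    [/\ proj_closed Z, proj_irreducible Z & isomorphic X (proj_fspace Z)].

End Varieties.

Section Toric.
Variables (R : realType) (r : nat).
Local Notation V := 'rV[R]_r.
Local Notation V' := 'cV[R]_r.

(* The monoid of lattice points of the dual cone of [s]. *)
Definition dual_monoid (M : set V') (s : set V) : set V' :=
  M `&` [set m | forall x, s x -> 0 <= ev m x].

(* The monoid homomorphisms from [S] to the multiplicative monoid of C; as
   total functions on V^*, they are normalised to be 0 outside [S]. *)
Definition monoid_homs (S : set V') : set (V' -> R[i]) :=
  [set g | [/\ g 0 = 1, forall m m', S m -> S m' -> g (m + m') = g m * g m'
           & forall m, ~ S m -> g m = 0]].

(* The elements of the semigroup algebra C[S], as functions on Hom(S, C). *)
Definition semigroup_algebra (S : set V') :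
    set ({g | monoid_homs S g} -> R[i]) :=
  [set h | exists2 c : seq (R[i] * V'), (forall t, t \in c -> S t.2) &
     forall g, h g = \sum_(t <- c) t.1 * sval g t.2].
Arguments semigroup_algebra : clear implicits.

(* U_s = Spec C[S_s], with set of closed points Hom(S_s, C). *)
Definition toric_chart (M : set V') (s : set V) : fspace R[i] :=
  affine_fspace (semigroup_algebra (dual_monoid M s)).

(* U_s and U_t are glued along U_(s `&` t), which maps to both of them by
   restriction of homomorphisms. *)
Definition toric_gluing (M : set V') (Sigma : set (set V))
    (p q : {s : {s | Sigma s} & toric_chart M (sval s)}) : Prop :=
  let S u := dual_monoid M u in
  let s := sval (tag p) in let t := sval (tag q) in
  exists2 g, monoid_homs (S (s `&` t)) g &
    (forall m, S s m -> sval (tagged p) m = g m) /\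
    (forall m, S t m -> sval (tagged q) m = g m).

(* X_Sigma, for a fan [Sigma] in the lattice [N]. *)
Definition toric_variety (N : set V) (Sigma : set (set V)) : fspace R[i] :=
  glue (@toric_gluing (character_lattice N) Sigma).

End Toric.

(* Main.v *)
(** For [y] in V the linear form [y] takes on [rho^K] the value
    [-1/4 \sum_(a in R) |a(y)| + 1/2 \sum_(a in R^K_+) (|a(y)| + a(y))], so it is
    minimal there exactly when [-y] lies in the closure of [K]. Hence the normal
    fan of [P] and the fan of the arrangement are the same set of cones (both are
    stable under [-1]), and the isomorphism with [X_P] is the identity.

    For projectivity, take as homogeneous coordinates the characters
    [\sum_(a in T) a], for all subsets [T] of [R]: they are lattice points of
    [2P], contain its vertices [v_K = \sum_(a in R, a < 0 on K) a], and together
    with [v_K] also contain [v_K + b] for [b] in [B^K]. The latter makes every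
    chart of a chamber a closed subset of an affine chart of projective space.
    The image of the embedding is the set [Z] of solutions of all homogeneous
    binomial equations. A point [w] of [Z] defines a homomorphism on the monoid
    of all [b - a] with [w_a != 0], where [a] and [b] are sums of equally many
    exponents; this monoid contains [a] or [-a] for each root [a], hence all
    positive roots of some chamber, and so [w] lies in the chart of that chamber.
    Irreducibility of [Z] follows by joining points of a chart, which is an
    affine space, by lines. *)

From HB Require Import structures.
From mathcomp Require Import all_boot all_order all_algebra.
From mathcomp Require Import complex.
From mathcomp Require Import mpoly.
From mathcomp Require Import boolp classical_sets cardinality fsbigop reals.
From mathcomp Require Import topology normedtype.
From mathcomp Require Import finmap.
From mathcomp Require Import lra ring.
Require Import Defs.

Set Implicit Arguments.
Unset Strict Implicit.
Unset Printing Implicit Defensive.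

Import Order.TTheory GRing.Theory Num.Theory numFieldNormedType.Exports.
Local Open Scope classical_set_scope.
Local Open Scope ring_scope.

(** Among [size q] distinct naturals at least one is not a root, by counting. *)
Lemma poly_nonroot (K : numFieldType) (q : {poly K}) : q != 0 -> exists t, q.[t] != 0.
Proof.
move=> q0; pose s := [seq (i%:R : K) | i <- iota 0 (size q)].
have us : uniq s.
  by rewrite map_inj_uniq ?iota_uniq // => i j /eqP; rewrite eqr_nat => /eqP.
have /allPn[t _ rt] : ~~ all (root q) s.
  apply/negP => h; have := max_poly_roots q0 h us.
  by rewrite size_map size_iota ltnn.
by exists t.
Qed.

(** * Roots and chambers *)

Section Evaluation.
Variables (R : realType) (r : nat).
Local Notation V := 'rV[R]_r.
Local Notation V' := 'cV[R]_r.
Implicit Types (a b : V') (x y : V).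

Lemma evE a x : ev a x = \sum_k x 0 k * a k 0.
Proof. by rewrite /ev mxE. Qed.

Lemma evDl a b x : ev (a + b) x = ev a x + ev b x.
Proof. by rewrite /ev mulmxDr mxE. Qed.

Lemma evNl a x : ev (- a) x = - ev a x.
Proof. by rewrite /ev mulmxN mxE. Qed.

Lemma evZl c a x : ev (c *: a) x = c * ev a x.
Proof. by rewrite /ev -scalemxAr mxE. Qed.

Lemma ev0l x : ev 0 x = 0.
Proof. by rewrite /ev mulmx0 mxE. Qed.

Lemma evBl a b x : ev (a - b) x = ev a x - ev b x.
Proof. by rewrite evDl evNl. Qed.

Lemma evDr a x y : ev a (x + y) = ev a x + ev a y.
Proof. by rewrite /ev mulmxDl mxE. Qed.

Lemma evNr a x : ev a (- x) = - ev a x.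
Proof. by rewrite /ev mulNmx mxE. Qed.

Lemma evZr c a x : ev a (c *: x) = c * ev a x.
Proof. by rewrite /ev -scalemxAl mxE. Qed.

Lemma ev0r a : ev a 0 = 0.
Proof. by rewrite /ev mul0mx mxE. Qed.

Lemma ev_suml I (s : seq I) (P : pred I) (F : I -> V') x :
  ev (\sum_(i <- s | P i) F i) x = \sum_(i <- s | P i) ev (F i) x.
Proof. by apply: (big_morph (fun a => ev a x)) => [? ?|]; rewrite ?evDl ?ev0l. Qed.

Lemma ev_sumr I (s : seq I) (P : pred I) (F : I -> V) a :
  ev a (\sum_(i <- s | P i) F i) = \sum_(i <- s | P i) ev a (F i).
Proof. by apply: (big_morph (ev a)) => [? ?|]; rewrite ?evDr ?ev0r. Qed.

Lemma evMzl a (n : int) x : ev (a *~ n) x = ev a x *~ n.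
Proof. by rewrite -scaler_int evZl mulrzl. Qed.

Lemma ev_mul a (c : V) (B : 'M[R]_r) :
  ev a (c *m B) = \sum_i c 0 i * ev a (row i B).
Proof.
rewrite mulmx_sum_row ev_sumr; apply: eq_bigr => i _; exact: evZr.
Qed.

Lemma ev_inj a b : (forall x, ev a x = ev b x) -> a = b.
Proof.
move=> h; apply/matrixP => i j; rewrite !ord1.
have e c : ev c (delta_mx 0 i) = c i 0.
  by rewrite /ev -rowE mxE.
by rewrite -!e.
Qed.

Lemma ev_continuous a : continuous (ev a).
Proof.
have -> : ev a = (fun x : V => \sum_(k < r) x 0 k * a k 0).
  by apply/funext => x; rewrite evE.
move=> x; have FF : Filter (nbhs x) by exact: nbhs_filter.
apply: (@cvg_big _ _ (fun u v : R^o => u + v)) => [|k _]; first exact: add_continuous.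
apply: (@cvgM _ _ _ FF); last exact: cvg_cst.
exact: coord_continuous.
Qed.

Lemma line_continuous x y : continuous (fun t : R => x + t *: y).
Proof.
move=> t B [P hP hB].
have FF : Filter (nbhs t) by exact: nbhs_filter.
have : nbhs t [set u : R | forall j, P 0 j ((x + u *: y) 0 j)].
  apply: (@filter_forall _ _ (fun j u => P 0 j ((x + u *: y) 0 j)) _ FF) => j.
  have : (fun u : R => (x + u *: y) 0 j) @ t --> (x + t *: y) 0 j.
    have -> : (fun u : R => (x + u *: y) 0 j) = (fun u => x 0 j + u * y 0 j).
      by apply/funext => u; rewrite !mxE.
    rewrite !mxE; apply: cvgD; first exact: cvg_cst.
    by apply: cvgM; [exact: cvg_id|exact: cvg_cst].
  by apply; exact: hP.
by apply: filterS => u hu; apply: hB => /= i j; rewrite ord1.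
Qed.

End Evaluation.

Section Roots.
Variables (R : realType) (r : nat).
Local Notation V := 'rV[R]_r.
Local Notation V' := 'cV[R]_r.
Variables (A : set (set V)) (Phi : set V').
Hypothesis hA : crystallographic_arrangement A Phi.
Implicit Types (a b : V') (x y : V).

(** Otherwise [perp a] would be all of V, which is not a hyperplane. *)
Lemma root_neq0 a : Phi a -> a != 0.
Proof.
move=> Pa; have : A (perp a) by rewrite (cryst_perp hA); exists a.
case/(simplicial_hyperplanes (cryst_simplicial hA)) => b /eqP b0 ab.
apply/eqP => a0; apply: b0; apply: ev_inj => x; rewrite ev0l.
by have : perp b x by rewrite -ab a0 /perp /= ev0l.
Qed.

Lemma rootN a : Phi a -> Phi (- a).
Proof.
move=> Pa; have [_] : ([set c *: a | c in [set: R]] `&` Phi) (- a).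
  by rewrite (cryst_reduced hA Pa); right.
by [].
Qed.

Lemma root_scale a c : Phi a -> Phi (c *: a) -> 0 < c -> c *: a = a.
Proof.
move=> Pa Pca c0.
have : ([set c *: a | c in [set: R]] `&` Phi) (c *: a) by split => //; exists c.
rewrite (cryst_reduced hA Pa) => -[//|/= e].
have /eqP : (c + 1) *: a = 0 by rewrite scalerDl e scale1r addNr.
by rewrite scaler_eq0 (negPf (root_neq0 Pa)) orbF gt_eqF // addr_gt0.
Qed.

Definition generic x := forall a, Phi a -> ev a x != 0.

Lemma complementE x : complement A x <-> generic x.
Proof.
rewrite /complement (cryst_perp hA); split => [h a Pa|h [_ [a Pa <-]] /eqP].
  by apply/eqP => e; apply: h; exists (perp a) => //; exists a.
by apply/negP/h.
Qed.

(** For generic [x] this is the chamber of [x]. As roots come in opposite pairs, preserving the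
    positive values fixes all signs. *)
Definition cell x : set V := [set y | forall a, Phi a -> 0 < ev a x -> 0 < ev a y].

Definition ccell x : set V := [set y | forall a, Phi a -> 0 < ev a x -> 0 <= ev a y].

Lemma cell_refl x : cell x x.
Proof. by move=> a. Qed.

Lemma generic_dec x a : generic x -> Phi a -> 0 < ev a x \/ 0 < ev (- a) x.
Proof.
by move=> gx Pa; have := gx _ Pa; rewrite neq_lt evNl oppr_gt0 => /orP[]; [right|left].
Qed.

Lemma cell_generic x y : generic x -> cell x y -> generic y.
Proof.
move=> gx xy a Pa; have [h|h] := generic_dec gx Pa.
  by rewrite gt_eqF // xy.
by have := xy _ (rootN Pa) h; rewrite evNl oppr_gt0 => ?; rewrite lt_eqF.
Qed.

Lemma cell_sign x y a : generic x -> cell x y -> Phi a -> (0 < ev a y) = (0 < ev a x).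
Proof.
move=> gx xy Pa; apply/idP/idP; last exact: xy.
move=> h; have [//|h'] := generic_dec gx Pa.
by have := xy _ (rootN Pa) h'; rewrite evNl oppr_gt0 ltNge ltW.
Qed.

Lemma cell_eq x y : generic x -> cell x y -> cell y = cell x.
Proof.
move=> gx xy; apply/seteqP; split => z h a Pa;
  by [rewrite -(cell_sign gx xy Pa)//; apply: h|rewrite (cell_sign gx xy Pa); apply: h].
Qed.

Lemma ccell_generic x y : generic y -> ccell x y -> cell x y.
Proof. by move=> gy xy a Pa h; rewrite lt_def gy // xy. Qed.

Lemma ccell_sub x : cell x `<=` ccell x.
Proof. by move=> y xy a Pa h; apply/ltW/xy. Qed.

(** A root has no zero on a connected subset of the complement, so it keeps its sign there;
    conversely the segment from [x] to a point of the cell stays in the cell. *)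
Lemma componentE x : generic x -> connected_component (complement A) x = cell x.
Proof.
move=> gx; apply/seteqP; split => y.
  case=> B [Bx BA Bc] By a Pa ax.
  have /connected_intervalP iB : connected (ev a @` B).
    apply: connected_continuous_connected => //.
    by apply: continuous_subspaceT; apply: ev_continuous.
  rewrite ltNge; apply/negP => ay.
  have [] := iB (ev a y) (ev a x) (imageP _ By) (imageP _ Bx) 0.
    by rewrite ay ltW.
  by move=> z Bz az; have /complementE/(_ a Pa) := BA _ Bz; rewrite az eqxx.
move=> xy; exists ((fun t : R => x + t *: (y - x)) @` `[0, 1]) => /=; last first.
  by exists 1; [rewrite /= in_itv /= ler01 lexx|rewrite scale1r addrC subrK].
split.
- by exists 0; [rewrite /= in_itv /= ler01 lexx|rewrite scale0r addr0].
- move=> _ [t + <-]; rewrite /= in_itv /= => /andP[t0 t1].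
  apply/complementE; apply: (cell_generic gx) => a Pa ax.
  rewrite evDr evZr evDr evNr.
  have := xy a Pa ax; nra.
- apply: connected_continuous_connected; first exact: segment_connected.
  by apply: continuous_subspaceT; apply: line_continuous.
Qed.

Lemma chambersP K : chambers A K <-> exists2 x, generic x & K = cell x.
Proof.
by split=> [[x /complementE gx <-]|[x gx ->]]; exists x => //;
  [rewrite componentE|apply/complementE|rewrite componentE].
Qed.

(** Each inequality is closed. Conversely a point [y] of [ccell x] is the limit of the points
    [y + t *: x] of the open cell, as t > 0 tends to 0. *)
Lemma closure_cell x : generic x -> closure (cell x) = ccell x.
Proof.
move=> gx; apply/seteqP; split => y.
  move=> cy a Pa ax; have cl : closed [set u | 0 <= u :> R] by exact: closed_ge.
  have /closure_id h : closed (ev a @^-1` [set u | 0 <= u :> R]).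
    by apply: closed_comp => // z _; apply: ev_continuous.
  suff : (ev a @^-1` [set u | 0 <= u :> R]) y by [].
  rewrite h; apply: closure_subset cy => z xz /=.
  exact/ltW/xz.
move=> xy B hB.
have : nbhs (0 : R) ((fun t : R => y + t *: x) @^-1` B).
  by apply: line_continuous; rewrite scale0r addr0.
case/nbhs_ballP => e /= e0 he; exists (y + (e / 2) *: x); split; last first.
  by apply: he; rewrite /ball /= sub0r normrN ger0_norm; lra.
move=> a Pa ax; rewrite evDr evZr.
by apply: ltr_wpDl; [exact: xy|apply: mulr_gt0; lra].
Qed.

Definition roots : seq V' := fset_set Phi.

Lemma mem_roots a : (a \in roots) = (a \in Phi).
Proof. by rewrite /roots (in_fset_set (cryst_finite hA)). Qed.

Lemma rootsP a : reflect (Phi a) (a \in roots).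
Proof. by rewrite mem_roots; apply: (iffP idP) => [/set_mem|/mem_set]. Qed.

Lemma roots_uniq : uniq roots.
Proof. exact: fset_uniq. Qed.

(** On the moment curve (1, t, t^2, ...) every root becomes a nonzero polynomial in t, so some t
    avoids the zeros of all of them. *)
Lemma exists_generic : exists x, generic x.
Proof.
pose q (a : V') : {poly R} := \poly_(i < r) (if insub i is Some j then a j 0 else 0).
have qE a t : (q a).[t] = ev a (\row_j t ^+ j).
  rewrite horner_poly evE; apply: eq_bigr => i _.
  by rewrite insubT // => lti; rewrite mxE mulrC; congr (_ * a _ _); exact: val_inj.
have q0 a : Phi a -> q a != 0.
  move=> Pa; apply/eqP => e; have /eqP := root_neq0 Pa; apply.
  apply/matrixP => i j; rewrite ord1 mxE.
  have := congr1 (fun p : {poly R} => p`_i) e.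
  rewrite coef0 coef_poly ltn_ord insubT // => lti <-; congr (a _ _); exact: val_inj.
pose p := \prod_(a <- roots) q a.
have p0 : p != 0.
  by rewrite prodf_seq_neq0; apply/allP => a /rootsP; exact: q0.
have [t pt] := poly_nonroot p0; exists (\row_j t ^+ j) => a /rootsP Pa.
apply: contraNneq pt; rewrite -qE => h.
by rewrite /p horner_prod (big_rem a) //= h mul0r.
Qed.

End Roots.

(** * Simple roots as walls of a simplicial chamber *)

Section ChamberBasis.
Variables (R : realType) (r : nat).
Local Notation V := 'rV[R]_r.
Local Notation V' := 'cV[R]_r.
Variables (A : set (set V)) (Phi : set V').
Hypothesis hA : crystallographic_arrangement A Phi.
Implicit Types (a : V') (x y : V) (b : 'I_r -> V) (be : 'I_r -> V').

(** [be] enumerates B^K for the chamber K of [x], and the dual basis [b] spans the extremal rays of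
    the closed chamber. *)
Record chamber_basis x b be : Prop := ChamberBasis {
  basis_root : forall j, Phi (be j);
  basis_dual : forall i j, ev (be i) (b j) = (i == j)%:R;
  basis_gt0 : forall j, 0 < ev (be j) x;
  basis_ccell : forall j, ccell Phi x (b j);
  basis_simple : simple_roots Phi (cell Phi x) = range be
}.

Lemma ccellZ x y c : 0 <= c -> ccell Phi x y -> ccell Phi x (c *: y).
Proof. by move=> c0 hy a Pa ax; rewrite evZr mulr_ge0 ?hy. Qed.

Lemma ev_rows_eq0 (B : 'M[R]_r) a :
  B \in unitmx -> (forall i, ev a (row i B) = 0) -> a = 0.
Proof.
move=> uB h; apply: ev_inj => y; rewrite ev0l -(mulmxKV uB y) ev_mul.
by rewrite big1 // => i _; rewrite h mulr0.
Qed.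

Section Cone.
Variables (x : V) (B : 'M[R]_r).
Hypotheses (gx : generic Phi x) (uB : B \in unitmx)
  (xB : cell Phi x = [set y | exists2 c : V, (forall i, 0 < c 0 i) & y = c *m B]).

(** If [a] were negative on a generator, moving from an interior point along it would reach a zero
    of [a] inside the open cell. *)
Lemma cone_row_ccell i : ccell Phi x (row i B).
Proof.
move=> a Pa ax; rewrite leNgt; apply/negP => ai.
have h t : 0 <= t -> 0 < ev a (const_mx 1 *m B + t *: row i B).
  move=> t0; suff : cell Phi x (const_mx 1 *m B + t *: row i B) by apply.
  rewrite xB /=; exists (const_mx 1 + t *: delta_mx 0 i); last first.
    by rewrite mulmxDl -scalemxAl -rowE.
  by move=> k; rewrite !mxE ltr_pwDl // mulr_ge0.
have h0 : 0 < ev a (const_mx 1 *m B) by have := h 0 (lexx _); rewrite scale0r addr0.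
have := h (- (ev a (const_mx 1 *m B) / ev a (row i B))).
rewrite evDr evZr mulNr divfK ?lt_eqF // subrr ltxx => hf.
suff : false by []; apply: hf.
by rewrite -mulrN mulr_ge0 ?ltW // oppr_gt0 invr_lt0.
Qed.

(** The sum of all generators but the [j]-th lies in the closed cell and not in the open one, so a
    positive root vanishes there. It is nonnegative on the generators, hence vanishes on all but the
    [j]-th. *)
Lemma cone_wall j : exists a, [/\ Phi a, 0 < ev a x, 0 < ev a (row j B)
  & forall i, i != j -> ev a (row i B) = 0].
Proof.
pose c : V := \row_k (k != j)%:R.
have cc : ccell Phi x (c *m B).
  rewrite mulmx_sum_row => a Pa ax; rewrite ev_sumr sumr_ge0 // => i _.
  by rewrite evZr mulr_ge0 ?cone_row_ccell // mxE ler0n.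
have ncc : ~ cell Phi x (c *m B).
  rewrite xB => -[c' c'0 /(can_inj (mulmxK uB)) e].
  by have := c'0 j; rewrite -e mxE eqxx ltxx.
have [a Pa [ax ac]] : exists2 a, Phi a & 0 < ev a x /\ ev a (c *m B) = 0.
  apply: contrapT => h; apply: ncc; apply: ccell_generic => // a Pa.
  apply/eqP => e; apply: h; have [ax|ax] := generic_dec gx Pa; first by exists a.
  by exists (- a); [exact: (rootN hA)|split=> //; rewrite evNl e oppr0].
have z i : i != j -> ev a (row i B) = 0.
  move=> ij; move: ac; rewrite ev_mul => /psumr_eq0P h.
  have := h _ i isT; rewrite mxE ij mul1r; apply=> k _.
  by rewrite mulr_ge0 ?cone_row_ccell // mxE ler0n.
exists a; split => //; rewrite lt_def cone_row_ccell // andbT.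
apply/eqP => aj; have /eqP := root_neq0 hA Pa; apply.
apply: (ev_rows_eq0 uB) => i; have [->|/z//] := eqVneq i j; exact: aj.
Qed.

Variable be : 'I_r -> V'.
Hypotheses (beP : forall j, Phi (be j)) (bex : forall j, 0 < ev (be j) x)
  (bejj : forall j, 0 < ev (be j) (row j B))
  (beij : forall j i, i != j -> ev (be j) (row i B) = 0).

Lemma cone_coord j c : ev (be j) (c *m B) = c 0 j * ev (be j) (row j B).
Proof.
by rewrite ev_mul (bigD1 j) //= big1 ?addr0 // => i ij; rewrite beij ?mulr0.
Qed.

(** A root of B^K cannot be nonzero on two generators, as its zeros in the closed cell would then
    span too little; so it is a multiple of some [be j], and equal to it by reducedness. Conversely
    the generators other than the [j]-th span the wall of [be j]. *)
Lemma cone_simple : simple_roots Phi (cell Phi x) = range be.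
Proof.
apply/seteqP; split => [a [Pa a0 [C fC [Ca _]]]|_ [j _ <-]].
  have ax : 0 < ev a x by rewrite lt_def gx // a0 //; exact: cell_refl.
  have ar i : 0 <= ev a (row i B) by exact: cone_row_ccell.
  have [j aj] : exists j, ev a (row j B) != 0.
    apply: contrapT => h; have /eqP := root_neq0 hA Pa; apply.
    apply: (ev_rows_eq0 uB) => i; apply: contrapT => /eqP ai; apply: h; by exists i.
  have az k : k != j -> ev a (row k B) = 0.
    move=> kj; apply: contrapT => /eqP ak.
    (* The columns of [invmx B *m F] are the coordinates [j] and [k] with respect to [B]. They
       vanish on the r-1 independent rows of [C], which contradicts the rank bound. *)
    pose F : 'M[R]_(r, 2) := \matrix_(i, s) (i == if s == 0 then j else k)%:R.
    have rF : \rank F = 2.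
      rewrite -mxrank_tr; apply/eqP; rewrite -/(row_free _); apply/row_freeP.
      exists F; apply/matrixP => s t; rewrite !mxE.
      rewrite (bigD1 (if s == 0 then j else k)) //= !mxE eqxx mul1r.
      rewrite big1 ?addr0; last by move=> i /negPf ij; rewrite !mxE ij mul0r.
      move: s t; case=> [[|[|//]]] hs; case=> [[|[|//]]] ht //=;
        by rewrite ?eqxx // ?(negPf kj) // eq_sym (negPf kj).
    have CF : C *m (invmx B *m F) = 0.
      rewrite mulmxA; apply/matrixP => l s; rewrite mxE [RHS]mxE big1 // => i _.
      rewrite [F i s]mxE; case: eqP => [->|_]; last by rewrite mulr0.
      rewrite mulr1; set m := (if _ then _ else _).
      have am : ev a (row m B) != 0 by rewrite /m; case: ifP.
      have [/= pa clC] := Ca l; rewrite closure_cell // in clC.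
      have e0 : row l C = row l (C *m invmx B) *m B by rewrite -row_mul mulmxKV.
      have nn i' : 0 <= (C *m invmx B) l i'.
        have := clC _ (beP i') (bex i'); rewrite e0 cone_coord mxE.
        by rewrite pmulr_lge0.
      move: pa; rewrite /perp /= e0 ev_mul => /psumr_eq0P h.
      have := h _ m isT; rewrite mxE => /(_ _)/eqP; rewrite mulf_eq0 (negPf am) orbF.
      by move=> hh; apply/eqP/hh => i' _; rewrite mxE mulr_ge0.
    have := mulmx0_rank_max CF; move: fC => /eqP ->.
    rewrite -[\rank (_ *m _)]mxrank_tr trmx_mul.
    rewrite mxrankMfree ?row_free_unit ?unitmx_tr ?unitmx_inv // mxrank_tr rF.
    by rewrite addn2 prednK ?ltnn // (leq_ltn_trans _ (ltn_ord j)).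
  exists j => //; pose c := ev a (row j B) / ev (be j) (row j B).
  have c0 : 0 < c by rewrite divr_gt0 // lt_def aj ar.
  have e : a = c *: be j.
    apply/eqP; rewrite -subr_eq0; apply/eqP; apply: (ev_rows_eq0 uB) => i.
    rewrite evBl evZl; have [->|ij] := eqVneq i j; last by rewrite az // beij // mulr0 subrr.
    by rewrite divfK ?subrr // gt_eqF.
  by rewrite e (root_scale hA) // -e.
split => //; first by move=> y xy; apply/ltW/xy.
rewrite closure_cell //; exists (row' j B).
  apply/row_freeP; exists (col' j (invmx B)); apply/matrixP => i k.
  have -> : (row' j B *m col' j (invmx B)) i k = (B *m invmx B) (lift j i) (lift j k).
    by rewrite !mxE; apply: eq_bigr => l _; rewrite !mxE.
  by rewrite mulmxV // !mxE (inj_eq lift_inj).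
split=> [i|y [/= + _]].
  have -> : row i (row' j B) = row (lift j i) B by apply/matrixP => ? ?; rewrite !mxE.
  by split; [rewrite /perp /= beij // eq_sym neq_lift|exact: cone_row_ccell].
rewrite /perp /= -(mulmxKV uB y) cone_coord => /eqP; rewrite mulf_eq0 (gt_eqF (bejj j)) orbF.
set c := y *m _ => /eqP cj; rewrite mulmx_sum_row summx_sub // => i _.
have [->|ij] := eqVneq i j; first by rewrite cj scale0r sub0mx.
apply: scalemx_sub; rewrite eq_sym in ij; have [k -> _] := unlift_some ij.
have -> : row (lift j k) B = row k (row' j B) by apply/matrixP => ? ?; rewrite !mxE.
exact: row_sub.
Qed.

End Cone.
End ChamberBasis.

(** * Coordinates with respect to the simple roots *)

Section BasisTheory.
Variables (R : realType) (r : nat).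
Local Notation V := 'rV[R]_r.
Local Notation V' := 'cV[R]_r.
Variables (A : set (set V)) (Phi : set V').
Hypothesis hA : crystallographic_arrangement A Phi.
Implicit Types (a m : V') (x y : V) (b : 'I_r -> V) (be : 'I_r -> V').
Local Notation roots := (roots Phi).

Lemma chamber_basis_exists x : generic Phi x -> exists b be, chamber_basis Phi x b be.
Proof.
move=> gx; have cx : chambers A (cell Phi x) by apply/(chambersP hA); exists x.
have [B uB xB] := simplicial_chambers (cryst_simplicial hA) cx.
have /choice[be hbe] := cone_wall hA gx uB xB.
have beP j : Phi (be j) by case: (hbe j).
have bex j : 0 < ev (be j) x by case: (hbe j).
have bejj j : 0 < ev (be j) (row j B) by case: (hbe j).
have beij j i : i != j -> ev (be j) (row i B) = 0 by case: (hbe j) => _ _ _; apply.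
exists (fun j => (ev (be j) (row j B))^-1 *: row j B), be; split => //.
- move=> i j; rewrite evZr; have [->|ij] := eqVneq i j.
    by rewrite mulVf // gt_eqF.
  have ji : j != i by rewrite eq_sym.
  by rewrite (beij _ _ ji) mulr0.
- move=> j; apply: ccellZ; last exact: cone_row_ccell.
  by rewrite invr_ge0 ltW.
- exact: (cone_simple hA gx uB xB).
Qed.

Lemma int_spanP m : int_span Phi m <-> exists c : V' -> int, m = \sum_(a <- roots) a *~ c a.
Proof.
by split=> -[c ->]; exists c; rewrite fsbig_finite //; exact: cryst_finite hA.
Qed.

Lemma int_span0 : int_span Phi 0.
Proof. by apply/int_spanP; exists (fun=> 0); rewrite big1. Qed.

Lemma int_spanD m m' : int_span Phi m -> int_span Phi m' -> int_span Phi (m + m').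
Proof.
move=> /int_spanP[c ->] /int_spanP[c' ->]; apply/int_spanP.
exists (fun a => c a + c' a); rewrite -big_split /=.
by apply: eq_bigr => a _; rewrite mulrzDr.
Qed.

Lemma int_spanMz m n : int_span Phi m -> int_span Phi (m *~ n).
Proof.
move=> /int_spanP[c ->]; apply/int_spanP; exists (fun a => c a * n).
by rewrite mulrz_suml; apply: eq_bigr => a _; rewrite mulrzA.
Qed.

Lemma int_span_root a : Phi a -> int_span Phi a.
Proof.
move=> Pa; apply/int_spanP; exists (fun a' => (a' == a)%:R).
rewrite (bigD1_seq a) ?roots_uniq //=; last exact/(rootsP hA).
by rewrite eqxx mulr1z big1 ?addr0 // => a' /negPf ->; rewrite mulr0z.
Qed.

Lemma int_span_sum I (s : seq I) (P : pred I) (F : I -> V') :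
  (forall i, P i -> int_span Phi (F i)) -> int_span Phi (\sum_(i <- s | P i) F i).
Proof.
move=> h; apply: (big_ind (fun m => int_span Phi m)) => //; first exact: int_span0.
exact: int_spanD.
Qed.

Section Basis.
Variables (x : V) (b : 'I_r -> V) (be : 'I_r -> V').
Hypotheses (gx : generic Phi x) (hb : chamber_basis Phi x b be).

Lemma basis_sumr y : y = \sum_j ev (be j) y *: b j.
Proof.
pose B : 'M[R]_r := \matrix_j b j; pose C : 'M[R]_r := \matrix_(i, j) be j i 0.
have e z j : (z *m C) 0 j = ev (be j) z.
  by rewrite mxE evE; apply: eq_bigr => k _; rewrite mxE.
have BC : B *m C = 1%:M.
  apply/matrixP => i j; rewrite !mxE -[RHS]/((i == j)%:R) eq_sym -(basis_dual hb) evE.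
  by apply: eq_bigr => k _; rewrite !mxE.
rewrite -[LHS](mulmx1 y) -(mulmx1C BC) mulmxA mulmx_sum_row.
by apply: eq_bigr => j _; rewrite e rowK.
Qed.

Lemma basis_ev m y : ev m y = \sum_j ev m (b j) * ev (be j) y.
Proof.
by rewrite {1}(basis_sumr y) ev_sumr; apply: eq_bigr => j _; rewrite evZr mulrC.
Qed.

Lemma basis_suml m : m = \sum_j ev m (b j) *: be j.
Proof.
by apply: ev_inj => y; rewrite basis_ev ev_suml; apply: eq_bigr => j _; rewrite evZl.
Qed.

Lemma basis_eq m m' : (forall j, ev m (b j) = ev m' (b j)) -> m = m'.
Proof.
by move=> h; rewrite (basis_suml m) (basis_suml m'); apply: eq_bigr => j _; rewrite h.
Qed.

Lemma basis_ev_sum j (c : 'I_r -> R) : ev (\sum_i c i *: be i) (b j) = c j.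
Proof.
rewrite ev_suml (bigD1 j) //= evZl (basis_dual hb) eqxx mulr1 big1 ?addr0 // => i ij.
by rewrite evZl (basis_dual hb) (negPf ij) mulr0.
Qed.

Lemma basis_ccellP y : ccell Phi x y <-> forall j, 0 <= ev (be j) y.
Proof.
split=> [h j|h a Pa ax]; first exact: (h _ (basis_root hb j) (basis_gt0 hb j)).
by rewrite basis_ev sumr_ge0 // => j _; rewrite mulr_ge0 // (basis_ccell hb).
Qed.

Lemma finite_range : finite_set (range be).
Proof. by apply: finite_image; exact: finite_finset. Qed.

(** For roots this is the crystallographic condition, applied to the chamber of [x]; it extends to
    [int_span Phi] by additivity. *)
Lemma basis_int m j : int_span Phi m -> ev m (b j) \is a Num.int.
Proof.
have P a i : Phi a -> ev a (b i) \is a Num.int.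
  move=> Pa; have cx : chambers A (cell Phi x) by apply/(chambersP hA); exists x.
  have [c ->] := cryst_integral hA cx Pa; rewrite (basis_simple hb).
  rewrite fsbig_finite; last exact: finite_range.
  rewrite ev_suml big_seq rpred_sum // => a'.
  rewrite in_fset_set; last exact: finite_range.
  move=> /set_mem[k _ <-].
  by rewrite evMzl (basis_dual hb) rpredMz // rpred_nat.
move=> /int_spanP[c ->]; rewrite ev_suml big_seq rpred_sum // => a /(rootsP hA) Pa.
by rewrite evMzl rpredMz // P.
Qed.

(** So the simple roots of any chamber form a Z-basis of M. *)
Lemma basis_int_spanP m : int_span Phi m <-> forall j, ev m (b j) \is a Num.int.
Proof.
split=> [? j|h]; first exact: basis_int.
rewrite (basis_suml m); apply: int_span_sum => j _.
have /intrP[n ->] := h j; rewrite scaler_int.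
by apply/int_spanMz/int_span_root/(basis_root hb).
Qed.

Lemma basis_nat a j : Phi a -> 0 < ev a x -> exists n : nat, ev a (b j) = n%:R.
Proof.
move=> Pa ax; apply/natrP; rewrite natrEint basis_int ?(basis_ccell hb) //.
exact: int_span_root.
Qed.

Lemma positive_rootsE : positive_roots Phi (cell Phi x) = [set a | Phi a /\ 0 < ev a x].
Proof.
have fr := finite_range.
rewrite /positive_roots (basis_simple hb); apply/seteqP; split => a [Pa].
  move=> [c c0 e]; split => //; rewrite lt_def gx // e fsbig_finite // ev_suml.
  rewrite big_seq sumr_ge0 // => a'; rewrite in_fset_set // => /set_mem[j _ <-].
  by rewrite evZl mulr_ge0 // ltW // (basis_gt0 hb).
move=> ax; split => //.
have bi : injective be.
  move=> i j e; have := basis_dual hb i j; rewrite e (basis_dual hb) eqxx.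
  by case: eqP => // _ /eqP; rewrite oner_eq0.
(* Coefficients in [nonneg_span] are indexed by vectors; at [be j] this sum has a single term, since
   [be] is injective. *)
exists (fun a' => \sum_(j | be j == a') ev a (b j)).
  by move=> a'; rewrite sumr_ge0 // => j _; rewrite (basis_ccell hb).
rewrite [LHS](basis_suml a) fsbig_finite //.
rewrite (perm_big [seq be j | j <- enum 'I_r]) /=; last first.
  apply: uniq_perm; rewrite ?fset_uniq ?(map_inj_uniq bi) ?enum_uniq // => a'.
  rewrite in_fset_set //; apply/idP/mapP => [/set_mem[j _ <-]|[j _ ->]].
    by exists j; rewrite ?mem_enum.
  by apply/mem_set; exists j.
rewrite big_map big_enum; apply: eq_bigr => j _.
by rewrite (big_pred1 j) // => i; rewrite /= (inj_eq bi).
Qed.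

Lemma rhoE : rho Phi (cell Phi x) = 2^-1 *: \sum_(a <- roots | 0 < ev a x) a.
Proof.
rewrite /rho positive_rootsE; congr (_ *: _).
have fS : finite_set [set a | Phi a /\ 0 < ev a x].
  by apply: sub_finite_set (cryst_finite hA) => a [].
rewrite fsbig_finite // -[in RHS]big_filter; apply: perm_big.
apply: uniq_perm; rewrite ?fset_uniq ?filter_uniq ?roots_uniq // => a.
rewrite in_fset_set // mem_filter; apply/idP/andP => [/set_mem[? ?]|[? /(rootsP hA)]].
  by split => //; apply/(rootsP hA).
by move=> ?; apply/mem_set.
Qed.

(** [x'] lies just beyond the wall of [be j]. A positive root has a natural value at the sum of the
    [b i] with i != j, a point of the wall, and this value is at least 1 unless the root is a
    multiple of [be j]. *)
Lemma reflection j : exists2 x', generic Phi x' & forall a, Phi a ->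
  0 < ev a x' -> a = - be j \/ 0 < ev a x /\ a != be j.
Proof.
(* So small that [e * ev a (b j)] is less than 1 for every root [a]; the summand 1 makes this
   strict. *)
pose e := (1 + \sum_(a <- roots) `|ev a (b j)|)^-1.
have S0 : 0 <= \sum_(a <- roots) `|ev a (b j)| by rewrite sumr_ge0.
have e0 : 0 < e by rewrite invr_gt0 ltr_pwDl.
pose x' := \sum_(i | i != j) b i - e *: b j.
have evx' a : ev a x' = \sum_(i | i != j) ev a (b i) - e * ev a (b j).
  by rewrite evDr evNr evZr ev_sumr.
have pos a : Phi a -> 0 < ev a x -> a != be j -> 0 < ev a x'.
  move=> Pa ax aj; rewrite evx' subr_gt0; apply: (@lt_le_trans _ _ 1).
    apply: (@le_lt_trans _ _ (e * \sum_(a <- roots) `|ev a (b j)|)).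
      rewrite ler_pM2l // (le_trans (ler_norm _)) // (bigD1_seq a) ?roots_uniq //=.
        by rewrite lerDl sumr_ge0.
      exact/(rootsP hA).
    by rewrite mulrC ltr_pdivrMr ?mul1r ?ltrDr // ltr_pwDl.
  have /natrP[[|n] en] : \sum_(i | i != j) ev a (b i) \is a Num.nat.
  - by apply: rpred_sum => i _; apply/natrP; exact: basis_nat.
  - move/psumr_eq0P: en => /(_ (fun i _ => basis_ccell hb i Pa ax)) z.
    have aE : a = ev a (b j) *: be j.
      apply: basis_eq => i; rewrite evZl (basis_dual hb) eq_sym.
      have [->|ij] := eqVneq i j; first by rewrite mulr1.
      by rewrite mulr0; apply: z.
    have bj : 0 < ev a (b j).
      rewrite lt_def (basis_ccell hb) // andbT; apply/eqP => z'.
      by have := root_neq0 hA Pa; rewrite aE z' scale0r eqxx.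
    case/eqP: aj; rewrite aE (root_scale hA) //; first exact: (basis_root hb).
    by rewrite -aE.
  - by rewrite en ler1n.
have neg : ev (be j) x' = - e.
  rewrite evx' (basis_dual hb) eqxx mulr1 big1 ?sub0r // => i ij.
  by rewrite (basis_dual hb) eq_sym (negPf ij).
have gp a : Phi a -> 0 < ev a x -> ev a x' != 0.
  move=> Pa ax; have [->|aj] := eqVneq a (be j); last by rewrite gt_eqF // pos.
  by rewrite neg oppr_eq0 gt_eqF.
exists x' => a Pa.
  have [ax|ax] := generic_dec gx Pa; first exact: gp.
  by have := gp _ (rootN hA Pa) ax; rewrite evNl oppr_eq0.
move=> ax'; have [ax|ax] := generic_dec gx Pa.
  right; split => //; apply/eqP => aj; move: ax'; rewrite aj neg oppr_gt0.
  by rewrite ltNge ltW.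
have [aj|aj] := eqVneq (- a) (be j); first by left; rewrite -aj opprK.
have := pos _ (rootN hA Pa) ax aj; rewrite evNl oppr_gt0 => /(lt_trans ax').
by rewrite ltxx.
Qed.

End Basis.
End BasisTheory.

(** * Lattice points of the dual cones *)

Section LatticeCones.
Variables (R : realType) (r : nat).
Local Notation V := 'rV[R]_r.
Local Notation V' := 'cV[R]_r.
Variables (A : set (set V)) (Phi : set V').
Hypothesis hA : crystallographic_arrangement A Phi.
Implicit Types (a m : V') (x y : V) (b : 'I_r -> V) (be : 'I_r -> V') (D : set V').
Implicit Types s t : set V.
Local Notation roots := (roots Phi).
Local Notation M := (int_span Phi).
Local Notation S := (dual_monoid M).

Lemma dual_monoid0 (L : set V') s : L 0 -> dual_monoid L s 0.
Proof. by move=> L0; split=> // y sy; rewrite ev0l. Qed.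

Lemma dual_monoidS (L : set V') s t : s `<=` t -> dual_monoid L t `<=` dual_monoid L s.
Proof. by move=> st m [Lm h]; split=> // y /st; exact: h. Qed.

Lemma dual_monoidD (L : set V') s m m' : (forall m m', L m -> L m' -> L (m + m')) ->
  dual_monoid L s m -> dual_monoid L s m' -> dual_monoid L s (m + m').
Proof.
by move=> LD [Lm h] [Lm' h']; split=> [|y sy]; [exact: LD|rewrite evDl addr_ge0 ?h ?h'].
Qed.

Lemma closed_sum D I (l : seq I) (P : pred I) (F : I -> V') : D 0 ->
  (forall m m', D m -> D m' -> D (m + m')) -> (forall i, P i -> D (F i)) ->
  D (\sum_(i <- l | P i) F i).
Proof. by move=> D0 DD h; apply: (big_ind (fun m => D m)). Qed.

Lemma closed_natmul D m n : D 0 -> (forall m m', D m -> D m' -> D (m + m')) ->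
  D m -> D (m *+ n).
Proof.
by move=> D0 DD Dm; elim: n => [|n IH]; rewrite ?mulr0n // mulrS; exact: DD.
Qed.

Lemma character_latticeK : character_lattice (dual_lattice M) = M.
Proof.
apply/seteqP; split=> m h; last by move=> x; apply.
have [x gx] := exists_generic hA; have [b [be hb]] := chamber_basis_exists hA gx.
apply/(basis_int_spanP hA gx hb) => j; apply: h => m' Mm'.
exact: (basis_int hA gx hb).
Qed.

(** The monoid is therefore freely generated by the simple roots [be], and its chart is an affine
    space. *)
Lemma dual_ccellP x b be m : generic Phi x -> chamber_basis Phi x b be ->
  S (ccell Phi x) m <-> forall j, ev m (b j) \is a Num.nat.
Proof.
move=> gx hb; split=> [[Mm h] j|h].
  by rewrite natrEint (basis_int hA gx hb) // h //; exact: (basis_ccell hb).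
split; first by apply/(basis_int_spanP hA gx hb) => j; exact: intr_nat.
move=> y /(basis_ccellP hb) hy; rewrite (basis_ev hb) sumr_ge0 // => j _.
by rewrite mulr_ge0 // natr_ge0.
Qed.

Lemma dual_ccell_root x a : generic Phi x -> Phi a -> 0 < ev a x -> S (ccell Phi x) a.
Proof. by move=> gx Pa ax; split; [exact: int_span_root hA _ Pa|move=> y; apply]. Qed.

Lemma dual_ccell_span x b be D : generic Phi x -> chamber_basis Phi x b be ->
  D 0 -> (forall m m', D m -> D m' -> D (m + m')) -> (forall j, D (be j)) ->
  S (ccell Phi x) `<=` D.
Proof.
move=> gx hb D0 DD Dbe m /(dual_ccellP _ gx hb) h; rewrite (basis_suml hb m).
apply: closed_sum => // j _; have /natrP[n ->] := h j.
by rewrite scaler_nat; apply: closed_natmul.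
Qed.

(* Cross a wall of the chamber whose root is not in [D], as long as there is
   one; each step decreases the number of positive roots outside [D]. *)
Lemma parabolic_chamber D : D 0 -> (forall m m', D m -> D m' -> D (m + m')) ->
  (forall a, Phi a -> D a \/ D (- a)) ->
  exists2 x, generic Phi x & S (ccell Phi x) `<=` D.
Proof.
move=> D0 DD Dor.
pose bad x a := (0 < ev a x) && ~~ `[< D a >].
have [x0 gx0] := exists_generic hA.
move: {2}(count (bad x0) roots).+1 (ltnSn (count (bad x0) roots)) => k.
elim: k x0 gx0 => // k IH x gx; rewrite ltnS => cx.
have [b [be hb]] := chamber_basis_exists hA gx.
have [h|] := pselect (forall j, D (be j)).
  by exists x => //; exact: dual_ccell_span hb D0 DD h.
move=> /existsNP[j nDj].
have [x' gx' hx'] := reflection hA gx hb j; apply: (IH x' gx').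
apply: leq_trans cx; rewrite -!sum1_count big_mkcond [X in (_ < X)%N]big_mkcond /=.
have Pj : be j \in roots by apply/(rootsP hA); exact: (basis_root hb).
have bj : bad x (be j) by rewrite /bad (basis_gt0 hb) /=; apply/asboolPn.
rewrite (bigD1_seq _ Pj) ?roots_uniq //= [X in (_ < X)%N](bigD1_seq _ Pj) ?roots_uniq //=.
(* The only root that becomes positive is [- be j], and it lies in [D] because [be j] does not. *)
have bad' a : a \in roots -> bad x' a -> bad x a && (a != be j).
  move=> /(rootsP hA) Pa /andP[ax' /asboolPn nDa].
  have [e|[ax ne]] := hx' a Pa ax'.
    by exfalso; apply: nDa; have [|//] := Dor _ (basis_root hb j); rewrite e.
  by rewrite /bad ax ne andbT; apply/asboolPn.
rewrite bj; case: ifP => [/(bad' _ Pj)|_]; first by rewrite eqxx andbF.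
rewrite add0n add1n ltnS big_seq_cond [X in (_ <= X)%N]big_seq_cond.
apply: leq_sum => a /andP[Pa aj]; case: ifP => // /(bad' _ Pa)/andP[-> _] //.
Qed.

(** [E] collects the roots positive on some chamber of the family; [x] comes from any one chamber of
    it, which exists as the family is nonempty. *)
Lemma fan_coneP s : arrangement_fan A s -> exists (E : set V') (x : V),
  [/\ E `<=` Phi, s = [set y | forall a, E a -> 0 <= ev a y],
      generic Phi x & s `<=` ccell Phi x].
Proof.
case=> F [FA [K0 FK0] ->].
exists [set a | Phi a /\ exists x, [/\ generic Phi x, F (cell Phi x) & 0 < ev a x]].
have /(chambersP hA)[x gx K0E] := FA _ FK0; exists x; split=> //.
- by move=> a [].
- apply/seteqP; split=> y h.
    move=> a [Pa [x' [gx' Fx' ax']]]; have := h _ Fx'.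
    by rewrite closure_cell //; apply.
  move=> K FK; have /(chambersP hA)[x' gx' KE] := FA _ FK.
  rewrite KE closure_cell // => a Pa ax'; apply: h; split => //.
  by exists x'; split=> //; rewrite -KE.
- by move=> y /(_ _ FK0); rewrite K0E closure_cell.
Qed.

Lemma ccell_fan x : generic Phi x -> arrangement_fan A (ccell Phi x).
Proof.
move=> gx; exists [set cell Phi x]; split.
- by move=> _ ->; apply/(chambersP hA); exists x.
- by exists (cell Phi x).
- by rewrite bigcap_set1 closure_cell.
Qed.

(** The monoid of a cone is a localization of that of a chamber containing it. The element [u] is a
    combination of the [be j] that vanish on [s], large enough to make the coordinates of [m] at
    these nonnegative. *)
Lemma fan_localization s : arrangement_fan A s -> exists x,
  [/\ generic Phi x, s `<=` ccell Phi x & forall m, S s m ->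
    exists u, [/\ S (ccell Phi x) u, S s (- u) & S (ccell Phi x) (m + u)]].
Proof.
move=> /fan_coneP[E [x [EP sE gx sx]]]; exists x; split=> // m [Mm ms].
have [b [be hb]] := chamber_basis_exists hA gx.
have mi j : ev m (b j) \is a Num.int by exact: (basis_int hA gx hb).
pose Z j := `[< forall y, s y -> ev (be j) y = 0 >].
pose k j := if Z j then `|ev m (b j)| else 0.
have kn j : k j \is a Num.nat.
  by rewrite /k; case: ifP => // _; exact: natr_norm_int.
exists (\sum_j k j *: be j); split.
- by apply/(dual_ccellP _ gx hb) => j; rewrite (basis_ev_sum hb).
- split.
    apply/(basis_int_spanP hA gx hb) => j.
    by rewrite evNl (basis_ev_sum hb) rpredN intr_nat.
  move=> y sy; rewrite evNl ev_suml big1 ?oppr0 // => j _.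
  by rewrite evZl /k; case: ifP => [/asboolP/(_ _ sy) ->|_]; rewrite ?mulr0 ?mul0r.
apply/(dual_ccellP _ gx hb) => j; rewrite evDl (basis_ev_sum hb) natrEint.
rewrite (rpredD (mi j) (intr_nat (kn j))) /= /k; case: ifP => [_|/asboolPn nz].
  by rewrite addrC -lerBlDr sub0r -normrN ler_norm.
(* For the other [j], the generator [b j] lies in [s]: a defining root that is negative on the
   chamber vanishes on [s], hence has coordinate 0 at [be j]. *)
rewrite addr0; apply: ms; rewrite sE => a Ea.
have [ax|ax] := generic_dec gx (EP _ Ea); first exact: (basis_ccell hb j (EP _ Ea) ax).
have az y : s y -> ev (- a) y = 0.
  move=> sy; apply/le_anti/andP; split; last exact: (sx _ sy _ (rootN hA (EP _ Ea)) ax).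
  by rewrite evNl oppr_le0; move: sy; rewrite sE; apply.
move: nz => /existsNP[y /not_implyP[sy /eqP ny]].
have := az _ sy; rewrite (basis_ev hb) => /psumr_eq0P h.
have := h _ j isT; move=> /(_ _)/eqP; rewrite mulf_eq0 (negPf ny) orbF => h'.
suff /eqP : ev (- a) (b j) == 0 by rewrite evNl => /eqP; rewrite oppr_eq0 => /eqP ->.
apply: h' => i _; rewrite mulr_ge0 ?(basis_ccell hb) //; first exact: (rootN hA (EP _ Ea)).
by move/(basis_ccellP hb): (sx _ sy); apply.
Qed.

(** If [- be j] lies in [D], any integral coordinate along [be j] is allowed. Otherwise the elements
    of [D], among them the defining roots of [s] and [t], are nonnegative at [b j]; so [b j] lies in
    the intersection and [m] is nonnegative there too. *)
Lemma fan_separation D x s t : generic Phi x -> (forall m m', D m -> D m' -> D (m + m')) ->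
  S (ccell Phi x) `<=` D ->
  (forall m, D m -> exists u, [/\ S (ccell Phi x) u, D (- u) & S (ccell Phi x) (m + u)]) ->
  arrangement_fan A s -> arrangement_fan A t -> S s `<=` D -> S t `<=` D ->
  S (s `&` t) `<=` D.
Proof.
move=> gx DD SD Dloc fs ft sD tD.
have [b [be hb]] := chamber_basis_exists hA gx.
have D0 : D 0 by apply: SD; apply: dual_monoid0; exact: int_span0 hA.
have Sbe j : S (ccell Phi x) (be j).
  exact: dual_ccell_root gx (basis_root hb j) (basis_gt0 hb j).
have Dge m j : D m -> ~ D (- be j) -> 0 <= ev m (b j).
  move=> Dm nDj; have [u [Su Du Smu]] := Dloc _ Dm.
  have /(dual_ccellP _ gx hb)/(_ j)/natrP[k uk] := Su.
  (* A positive coordinate [k] of [u] would put [- be j = - u + (u - be j)] into [D]. *)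
  suff k0 : k = 0%N.
    have /(dual_ccellP _ gx hb)/(_ j)/natr_ge0 := Smu.
    by rewrite evDl uk k0 addr0.
  case: k uk => // k uk; exfalso; apply: nDj.
  have -> : - be j = - u + (u - be j) by rewrite addKr.
  apply: DD => //; apply: SD.
  apply/(dual_ccellP _ gx hb) => i; rewrite evDl evNl (basis_dual hb).
  have [<-|ij] := eqVneq j i; first by rewrite uk -addn1 natrD addrK natr_nat.
  by rewrite oppr0 addr0; move/(dual_ccellP _ gx hb): Su.
have cone_b s' j : arrangement_fan A s' -> S s' `<=` D -> ~ D (- be j) -> s' (b j).
  move=> /fan_coneP[E [x' [EP sE gx' _]]] s'D nDj; rewrite sE => a Ea.
  apply: Dge => //; apply: s'D; split; first exact: (int_span_root hA (EP _ Ea)).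
  by rewrite sE => y; apply.
move=> m [Mm ms]; rewrite (basis_suml hb m); apply: closed_sum => // j _.
have /intrP[n mn] := basis_int hA gx hb j Mm; rewrite mn scaler_int.
have [Dj|nDj] := pselect (D (- be j)).
  case: n {mn} => n.
    by apply: closed_natmul => //; exact: SD.
  by rewrite NegzE mulrNz -mulNrz; apply: closed_natmul.
have : 0 <= ev m (b j) by apply: ms; split; exact: cone_b.
rewrite mn ler0z; case: n {mn} => // n _.
by apply: closed_natmul => //; exact: SD.
Qed.

Lemma sum_insert (c : pred V') a0 : Phi a0 -> ~~ c a0 ->
  \sum_(a <- roots | c a || (a == a0)) a = \sum_(a <- roots | c a) a + a0.
Proof.
move=> /(rootsP hA) Pa nc; rewrite big_mkcond [in RHS]big_mkcond /=.
rewrite (bigD1_seq _ Pa) ?roots_uniq //= [in RHS](bigD1_seq _ Pa) ?roots_uniq //=.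
rewrite eqxx orbT (negPf nc) add0r addrC; congr (_ + _).
by apply: eq_bigr => a /negPf ->; rewrite orbF.
Qed.

(** Subsets are encoded by Boolean functions on the positions in [roots]; a sum may occur under
    several indices. *)
Lemma subset_sums : exists n (p : 'I_n.+1 -> V'),
  (forall j, exists c : pred V', p j = \sum_(a <- roots | c a) a) /\
  (forall c : pred V', exists j, p j = \sum_(a <- roots | c a) a).
Proof.
pose T := {ffun 'I_(size roots) -> bool}.
pose pts : seq V' := [seq \sum_(i | f i) roots`_i | f : T].
have spts : (size pts).-1.+1 = size pts.
  by rewrite prednK // size_map -cardE card_ffun card_bool expn_gt0.
have sumE (c : pred V') :
    \sum_(a <- roots | c a) a = \sum_(i < size roots | c roots`_i) roots`_i.
  by rewrite (big_nth 0) big_mkord.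
exists (size pts).-1, (fun j => pts`_j); split=> [j|c].
  have /mapP[f _ ->] : pts`_j \in pts by rewrite mem_nth // (leq_trans (ltn_ord j)) ?spts.
  exists (fun a => if insub (index a roots) is Some i then f i else false).
  rewrite sumE; apply: eq_bigl => i.
  by rewrite index_uniq ?roots_uniq // valK.
have cp : \sum_(a <- roots | c a) a \in pts.
  apply/mapP; exists [ffun i : 'I_(size roots) => c roots`_i]; first by rewrite mem_enum.
  by rewrite sumE; apply: eq_bigl => i; rewrite ffunE.
have /(nthP 0)[i ip <-] := cp; rewrite -spts in ip.
by exists (Ordinal ip).
Qed.

(** Root by root the difference is 0, a positive root of the subset, or the opposite of a negative
    root outside it. *)
Lemma subset_sum_min x (c : pred V') : generic Phi x ->
  S (ccell Phi x) (\sum_(a <- roots | c a) a - \sum_(a <- roots | ev a x < 0) a).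
Proof.
move=> gx; rewrite big_mkcond [X in _ - X]big_mkcond -sumrB big_seq.
have S0 : S (ccell Phi x) 0 by apply: dual_monoid0; exact: int_span0 hA.
apply: closed_sum => //; first by move=> m m'; apply: dual_monoidD; exact: int_spanD hA.
move=> a /(rootsP hA) Pa; have [ax|ax] := generic_dec gx Pa.
  rewrite ltNge (ltW ax) /= subr0; case: ifP => // _; exact: dual_ccell_root.
move: (ax); rewrite evNl oppr_gt0 => ->; case: ifP => _; first by rewrite subrr.
by rewrite sub0r; apply: dual_ccell_root => //; exact: (rootN hA).
Qed.

End LatticeCones.

(** * The polytope and its normal fan *)

Section Polytope.
Variables (R : realType) (r : nat).
Local Notation V := 'rV[R]_r.
Local Notation V' := 'cV[R]_r.
Variables (A : set (set V)) (Phi : set V').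
Hypothesis hA : crystallographic_arrangement A Phi.
Implicit Types (a m : V') (x y z : V) (s : set V).
Local Notation roots := (roots Phi).
Local Notation vert := [set rho Phi K | K in chambers A].
Local Notation P := (convex_hull vert).

Lemma genericN x : generic Phi x -> generic Phi (- x).
Proof. by move=> gx a Pa; rewrite evNr oppr_eq0 gx. Qed.

Lemma ccellN x y : ccell Phi (- x) y <-> ccell Phi x (- y).
Proof.
split=> h a Pa ax.
  by have := h _ (rootN hA Pa); rewrite !evNl !evNr opprK; apply.
by have := h _ (rootN hA Pa); rewrite !evNl !evNr opprK -evNr; apply.
Qed.

(** The functionals that are nonnegative at [y] contain each root or its opposite, so
    [parabolic_chamber] applies. *)
Lemma ccell_exists y : exists2 x, generic Phi x & ccell Phi x y.
Proof.
have [||a Pa|x gx h] := parabolic_chamber hA (D := [set m | 0 <= ev m y]).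
- by rewrite /= ev0l.
- by move=> m m' /= h h'; rewrite evDl addr_ge0.
- by rewrite /= evNl oppr_ge0; apply/orP; exact: le_total.
- by exists x => // a Pa ax; apply: h; exact: (dual_ccell_root hA).
Qed.

Lemma sum_roots_pos x (F : V' -> R) : generic Phi x -> (forall a, F (- a) = F a) ->
  \sum_(a <- roots) F a = (\sum_(a <- roots | 0 < ev a x) F a) *+ 2.
Proof.
move=> gx FN; rewrite (bigID (fun a => 0 < ev a x)) /= mulr2n; congr (_ + _).
rewrite (perm_big [seq - a | a <- roots]) /=; last first.
  apply: uniq_perm; rewrite ?(map_inj_uniq oppr_inj) ?roots_uniq // => a.
  apply/idP/mapP => [/(rootsP hA) Pa|[a' /(rootsP hA) Pa' ->]].
    by exists (- a); rewrite ?opprK //; apply/(rootsP hA)/(rootN hA).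
  exact/(rootsP hA)/(rootN hA).
rewrite big_map big_seq_cond [RHS]big_seq_cond; apply: eq_big => a; last by rewrite FN.
apply: andb_id2l => /(rootsP hA) Pa; rewrite evNl oppr_gt0 -leNgt le_eqVlt.
by rewrite eq_sym (negPf (gx _ Pa)).
Qed.

(* The minimum of [y] on the polytope. *)
Definition supp_val y : R := - (\sum_(a <- roots) `|ev a y|) / 4%:R.

Lemma ev_rho x y : generic Phi x -> ev (rho Phi (cell Phi x)) y =
  supp_val y + (\sum_(a <- roots | 0 < ev a x) (`|ev a y| + ev a y)) / 2%:R.
Proof.
move=> gx; have [b [be hb]] := chamber_basis_exists hA gx.
rewrite (rhoE hA gx hb) evZl ev_suml big_split /= /supp_val.
rewrite (sum_roots_pos (F := fun a => `|ev a y|) gx); first by lra.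
by move=> a; rewrite evNl normrN.
Qed.

Lemma norm_add_ge0 (t : R) : 0 <= `|t| + t.
Proof. by rewrite -lerBlDr sub0r -normrN ler_norm. Qed.

Lemma rho_ge x y : generic Phi x -> supp_val y <= ev (rho Phi (cell Phi x)) y.
Proof.
move=> gx; rewrite ev_rho // lerDl divr_ge0 // sumr_ge0 // => a _; exact: norm_add_ge0.
Qed.

(** The summands |t| + t are nonnegative, and vanish exactly for t <= 0. *)
Lemma rho_eqP x y : generic Phi x ->
  ev (rho Phi (cell Phi x)) y = supp_val y <-> ccell Phi x (- y).
Proof.
move=> gx; have e t : (`|t : R| + t == 0) = (0 <= - t) by rewrite addr_eq0 -normrN eqr_norm_id.
rewrite ev_rho //; split=> [h a Pa ax|h].
  have /eqP : (\sum_(a <- roots | 0 < ev a x) (`|ev a y| + ev a y)) = 0 by move: h; lra.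
  rewrite psumr_eq0; last by move=> ? _; exact: norm_add_ge0.
  by move/allP/(_ a); rewrite ax e evNr; apply; apply/(rootsP hA).
rewrite big_seq_cond big1 ?mul0r ?addr0 // => a /andP[/(rootsP hA) Pa ax].
by apply/eqP; rewrite e -evNr; exact: h.
Qed.

Lemma vertP m : vert m -> exists2 x, generic Phi x & m = rho Phi (cell Phi x).
Proof. by move=> [K /(chambersP hA)[x gx ->] <-]; exists x. Qed.

Lemma hull_rho x : generic Phi x -> P (rho Phi (cell Phi x)).
Proof.
move=> gx; exists 1%N, (fun=> rho Phi (cell Phi x)), (fun=> 1).
rewrite !big_ord1 scale1r; split => // _.
by exists (cell Phi x) => //; apply/(chambersP hA); exists x.
Qed.

Lemma hull_ge m y : P m -> supp_val y <= ev m y.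
Proof.
move=> [n [p [t [pv t0 t1 ->]]]]; rewrite ev_suml -[supp_val y]mul1r -t1 mulr_suml.
apply: ler_sum => i _; rewrite evZl ler_wpM2l //.
by have [x gx ->] := vertP (pv i); exact: rho_ge.
Qed.

Lemma face_hullP m y : face_of P y m <-> P m /\ ev m y = supp_val y.
Proof.
split=> [[Pm h]|[Pm e]]; split=> //; last by move=> m' Pm'; rewrite e hull_ge.
have [x gx xy] := ccell_exists (- y); apply/le_anti; rewrite hull_ge // andbT.
have /(rho_eqP y gx) <- := xy; exact/h/hull_rho.
Qed.

Lemma face_rhoP x y : generic Phi x ->
  face_of P y (rho Phi (cell Phi x)) <-> ccell Phi x (- y).
Proof.
move=> gx; split=> [/face_hullP[_ /rho_eqP]|/rho_eqP e]; first exact.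
by apply/face_hullP; split; [exact: hull_rho|exact: e].
Qed.

(** The excess over the minimum is affine, so that of a convex combination is the combination of
    nonnegative excesses. *)
Lemma face_hull_comb y n (p : 'I_n -> V') (t : 'I_n -> R) :
  (forall i, vert (p i)) -> (forall i, 0 <= t i) -> \sum_i t i = 1 ->
  face_of P y (\sum_i t i *: p i) <-> forall i, t i = 0 \/ face_of P y (p i).
Proof.
move=> pv t0 t1; have hp i : P (p i).
  by have [x gx ->] := vertP (pv i); exact: hull_rho.
have key : ev (\sum_i t i *: p i) y - supp_val y = \sum_i t i * (ev (p i) y - supp_val y).
  rewrite ev_suml -[supp_val y]mul1r -{1}t1 mulr_suml -sumrB.
  by apply: eq_bigr => i _; rewrite evZl mulrBr mul1r.
split=> [/face_hullP[_ e] i|h].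
  move/esym: key; rewrite e subrr => /psumr_eq0P h.
  have /eqP : t i * (ev (p i) y - supp_val y) = 0.
    by apply: h => // k _; rewrite mulr_ge0 // subr_ge0 hull_ge.
  rewrite mulf_eq0 => /orP[/eqP|]; [by left|rewrite subr_eq0 => /eqP e'].
  by right; apply/face_hullP.
apply/face_hullP; split; first by exists n, p, t.
apply/eqP; rewrite -subr_eq0 key big1 // => i _.
by have [->|/face_hullP[_ ->]] := h i; rewrite ?mul0r // subrr mulr0.
Qed.

(** Faces are convex hulls of the points [rho] in them, by [face_hull_comb], so inclusion need only
    be tested there. *)
Lemma face_sub y z : face_of P y `<=` face_of P z <->
  forall x, generic Phi x -> ccell Phi x (- y) -> ccell Phi x (- z).
Proof.
split=> [h x gx /(face_rhoP _ gx)/h/(face_rhoP _ gx)//|h m fm].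
have [[n [p [t [pv t0 t1 mE]]]] _] := fm; move: fm; rewrite mE.
move=> /(face_hull_comb _ pv t0 t1) hi; apply/(face_hull_comb _ pv t0 t1) => i.
have [->|fi] := hi i; [by left|right; move: fi].
have [x gx ->] := vertP (pv i); move=> /(face_rhoP _ gx)/(h _ gx) ?.
exact/(face_rhoP _ gx).
Qed.

(** The form [- x] singles out [rho] of the chamber of [x]: a generic point lies in no other closed
    chamber. *)
Lemma vertices_hull : vertices P = vert.
Proof.
apply/seteqP; split=> [v [_ [y vE]]|_ /vertP[x gx ->]].
  have [x gx xy] := ccell_exists (- y).
  have : [set v] (rho Phi (cell Phi x)) by rewrite vE; apply/(face_rhoP _ gx).
  by move=> /= <-; exists (cell Phi x) => //; apply/(chambersP hA); exists x.
split; first by exists (rho Phi (cell Phi x)).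
exists (- x); apply/seteqP; split=> [_ ->|m fm].
  by apply/(face_rhoP _ gx); rewrite opprK; apply/ccell_sub/cell_refl.
have [[n [p [t [pv t0 t1 mE]]]] _] := fm; move: fm; rewrite mE.
move=> /(face_hull_comb _ pv t0 t1) hi /=.
rewrite -[RHS]scale1r -t1 scaler_suml; apply: eq_bigr => i _.
have [->|] := hi i; first by rewrite !scale0r.
have [x' gx' ->] := vertP (pv i); move=> /(face_rhoP _ gx'); rewrite opprK => x'x.
by rewrite (cell_eq hA gx' (ccell_generic gx x'x)).
Qed.

(** The point is a sum over the roots [a] of points of [s] at which [a] is positive, wherever there
    are such points. *)
Lemma fan_relative_interior s : arrangement_fan A s -> exists2 y, s y &
  forall a, Phi a -> (forall z, s z -> 0 <= ev a z) -> ev a y = 0 ->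
    forall z, s z -> ev a z = 0.
Proof.
move=> /(fan_coneP hA)[E [x [EP sE gx _]]].
have /choice[f hf] : forall a, exists y, s y /\ ((exists2 z, s z & 0 < ev a z) -> 0 < ev a y).
  move=> a; have [[z sz az]|n] := pselect (exists2 z, s z & 0 < ev a z).
    by exists z.
  by exists 0; split => //; rewrite sE => a' _; rewrite ev0r.
exists (\sum_(a <- roots) f a).
  rewrite sE => a Ea; rewrite ev_sumr sumr_ge0 // => a' _.
  by have [+ _] := hf a'; rewrite sE; apply.
move=> a Pa a0; rewrite ev_sumr => e z sz; apply/eqP; rewrite eq_le a0 // andbT leNgt.
apply/negP => az; have [_ /(_ (ex_intro2 _ _ z sz az))] := hf a.
move: e; rewrite (bigD1_seq a) ?roots_uniq //=; last exact/(rootsP hA).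
set u := ev a (f a); have : 0 <= \sum_(i <- roots | i != a) ev a (f i).
  by rewrite sumr_ge0 // => a' _; apply: a0; case: (hf a').
lra.
Qed.

(** The normal cone of the face at [y] is the intersection of all closed chambers that contain [y].
    A cone [s] of the fan arises in this way from a relatively interior point. *)
Lemma normal_fan_hull : normal_fan P = arrangement_fan A.
Proof.
apply/seteqP; split=> [_ [Q [_ [y QE]] <-]|s fs].
  exists [set cell Phi (- x) | x in [set x | generic Phi x /\ ccell Phi x (- y)]]; split.
  - move=> _ [x [gx _] <-]; apply/(chambersP hA).
    by exists (- x) => //; exact: genericN.
  - have [x gx xy] := ccell_exists (- y); exists (cell Phi (- x)); by exists x.
  rewrite QE; apply/seteqP; split=> z.
    move=> /face_sub h _ [x [gx xy] <-]; rewrite closure_cell //; last exact: genericN.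
    exact/ccellN/h.
  move=> h; apply/face_sub => x gx xy; apply/ccellN.
  by rewrite -closure_cell //; [apply: h; exists x|exact: genericN].
have [y sy ry] := fan_relative_interior fs.
have [E [x0 [EP sE gx0 sx0]]] := fan_coneP hA fs.
exists (face_of P y).
  split; last by exists y.
  have [x gx xy] := ccell_exists (- y); exists (rho Phi (cell Phi x)).
  exact/(face_rhoP _ gx).
apply/seteqP; split=> z.
  have [F [FA _ sF]] := fs; move=> /face_sub h; rewrite sF => K FK.
  have /(chambersP hA)[x gx KE] := FA _ FK; rewrite KE closure_cell //.
  rewrite -[x]opprK; apply/ccellN/h; first exact: genericN.
  apply/ccellN; rewrite opprK -closure_cell // -KE.
  by move: sy; rewrite sF; apply.
move=> sz; apply/face_sub => x gx /ccellN xy; apply/ccellN => a Pa ax.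
have [ax0|ax0] := generic_dec gx0 Pa; first exact: sx0.
(* Here [- a] is nonnegative on [s] and nonpositive at the relatively interior point [y], so it
   vanishes on [s]. *)
have aN z' : s z' -> 0 <= ev (- a) z'.
  by move=> sz'; exact: (sx0 _ sz' _ (rootN hA Pa) ax0).
suff /eqP : ev (- a) z = 0 by rewrite evNl oppr_eq0 => /eqP ->.
apply: (ry _ (rootN hA Pa)) => //; apply/le_anti; rewrite aN // andbT.
by rewrite evNl oppr_le0; exact: xy.
Qed.

End Polytope.

(** * Binomial equations in projective space *)

Section ProjectiveCoordinates.
Variables (C : fieldType) (n : nat).
Local Notation PV := 'rV[C]_n.+1.
Implicit Types (v w : PV) (z : proj_space C n) (F : {mpoly C[n.+1]}).

Lemma line_dim w : w != 0 -> \dim <[w]>%VS == 1%N.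
Proof. by move=> w0; rewrite dim_vline w0. Qed.

Definition proj_point w (w0 : w != 0) : proj_space C n := exist _ <[w]>%VS (line_dim w0).

Lemma coords_proj_point w (w0 : w != 0) : coords (proj_point w0) w.
Proof. by split=> //=; exact: memv_line. Qed.

Lemma coords_line z v : coords z v -> val z = <[v]>%VS.
Proof.
case: z => L /= /eqP L1 [v0 /= vL]; apply/eqP; rewrite eq_sym eqEdim -memvE vL.
by rewrite dim_vline v0 L1.
Qed.

Lemma coords_inj z z' v : coords z v -> coords z' v -> z = z'.
Proof. by move=> /coords_line h /coords_line h'; apply: val_inj; rewrite h h'. Qed.

Lemma coordsP z v : coords z v -> forall w, coords z w <-> exists2 a, a != 0 & w = a *: v.
Proof.
move=> zv w; have [v0 _] := zv; split=> [[w0]|[a a0 ->]].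
  rewrite (coords_line zv) => /vlineP[a e]; exists a => //.
  by apply: contraNneq w0 => a0; rewrite e a0 scale0r.
split; first by rewrite scaler_eq0 negb_or a0.
by rewrite (coords_line zv) memvZ ?memv_line.
Qed.

Lemma coords_exists z : exists v, coords z v.
Proof.
have zz : val z != 0%VS by rewrite -dimv_eq0 (eqP (valP z)).
by exists (vpick (val z)); split; rewrite ?vpick0 ?memv_pick.
Qed.

Lemma pevalZ F d a v : F \is d.-homog -> peval F (a *: v) = a ^+ d * peval F v.
Proof.
move=> /dhomogP hF; rewrite /peval !mevalE mulr_sumr big_seq [RHS]big_seq.
apply: eq_bigr => m mF; rewrite mulrCA; congr (_ * _).
have <- : mdeg m = d by exact: hF.
rewrite mdegE -prodrXr -big_split /=; apply: eq_bigr => i _.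
by rewrite mxE exprMn.
Qed.

Lemma pevalM F1 F2 v : peval (F1 * F2) v = peval F1 v * peval F2 v.
Proof. exact: mevalM. Qed.

Lemma peval_exp F d v : peval (F ^+ d) v = peval F v ^+ d.
Proof. by elim: d => [|d IH]; rewrite ?expr0 ?exprS ?pevalM ?IH // /peval meval1. Qed.

Lemma pevalX j v : peval ('X_j) v = v 0 j.
Proof. exact: mevalXU. Qed.

Lemma X_homog j : ('X_j : {mpoly C[n.+1]}) \is 1.-homog.
Proof. by rewrite dhomogX; apply/eqP; exact: mdeg1. Qed.

Lemma Xexp_homog j d : ('X_j ^+ d : {mpoly C[n.+1]}) \is d.-homog.
Proof. by rewrite -[X in X.-homog]mul1n; apply/dhomogMn/X_homog. Qed.

(** Monomials are encoded as sequences of indices: length is degree and concatenation is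
    multiplication. *)
Definition seq_val w (l : seq 'I_n.+1) : C := \prod_(j <- l) w 0 j.

Definition seq_monomial (l : seq 'I_n.+1) : {mpoly C[n.+1]} := \prod_(j <- l) 'X_j.

Lemma seq_monomial_homog l : seq_monomial l \is (size l).-homog.
Proof.
rewrite /seq_monomial; elim: l => [|j l IH]; first by rewrite big_nil; exact: dhomog1.
by rewrite big_cons; apply: (dhomogM (X_homog j) IH).
Qed.

Lemma peval_seq_monomial l w : peval (seq_monomial l) w = seq_val w l.
Proof.
rewrite /seq_monomial /seq_val; elim: l => [|j l IH].
  by rewrite !big_nil /peval meval1.
by rewrite !big_cons pevalM pevalX IH.
Qed.

Lemma peval_prod w : peval (\prod_j 'X_j) w = \prod_j w 0 j.
Proof.
apply: (big_ind2 (fun F x => peval F w = x)) => [|F1 x F2 y <- <-|j _].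
- by rewrite /peval meval1.
- exact: pevalM.
- exact: pevalX.
Qed.

Lemma peval_poly F (q : 'I_n.+1 -> {poly C}) :
  exists Q : {poly C}, forall t, Q.[t] = peval F (\row_j (q j).[t]).
Proof.
exists (\sum_(m <- msupp F) (F@_m)%:P * \prod_j q j ^+ m j) => t.
rewrite /peval mevalE horner_sum; apply: eq_bigr => m _.
rewrite hornerM hornerC horner_prod; congr (_ * _); apply: eq_bigr => j _.
by rewrite horner_exp mxE.
Qed.

Lemma seq_val_cat w l l' : seq_val w (l ++ l') = seq_val w l * seq_val w l'.
Proof. exact: big_cat. Qed.

Lemma seq_val1 w j : seq_val w [:: j] = w 0 j.
Proof. exact: big_seq1. Qed.

Lemma seq_val_nseq w j d : seq_val w (nseq d j) = w 0 j ^+ d.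
Proof. by rewrite /seq_val; elim: d => [|d IH]; rewrite /= ?big_nil ?big_cons ?IH ?exprS. Qed.

Lemma seq_valZ a w l : seq_val (a *: w) l = a ^+ size l * seq_val w l.
Proof.
rewrite /seq_val; elim: l => [|j l IH]; first by rewrite !big_nil expr0 mul1r.
by rewrite !big_cons IH mxE /= exprS mulrACA.
Qed.

End ProjectiveCoordinates.

(** * Homomorphisms defined by solutions of binomial equations *)

Section Localization.
Variables (R : realType) (r n : nat).
Local Notation V := 'rV[R]_r.
Local Notation V' := 'cV[R]_r.
Local Notation C := R[i].
Local Notation PV := 'rV[C]_n.+1.
Variable p : 'I_n.+1 -> V'.
Implicit Types (l : seq 'I_n.+1) (w : PV) (m : V') (z : proj_space C n).

Definition weight l : V' := \sum_(j <- l) p j.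

Definition binomial w : Prop := forall l l',
  size l = size l' -> weight l = weight l' -> seq_val w l = seq_val w l'.

(* The value at [m] of the homomorphism defined by the point [w]; [loc w] is its
   domain, and [loc_val w] its extension by 0. *)
Definition loc_frac w m (x : C) : Prop := exists l l',
  [/\ size l = size l', seq_val w l' != 0, m = weight l - weight l'
    & x = seq_val w l / seq_val w l'].

Definition loc w : set V' := [set m | exists x, loc_frac w m x].

Definition loc_val w m : C := xget 0 (loc_frac w m).

Lemma weight_cat l l' : weight (l ++ l') = weight l + weight l'.
Proof. exact: big_cat. Qed.

Lemma weight_nseq d j : weight (nseq d j) = p j *+ d.
Proof.
by rewrite /weight; elim: d => [|d IH]; rewrite /= ?big_nil ?big_cons ?IH ?mulrS.
Qed.

Lemma weight1 j : weight [:: j] = p j.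
Proof. exact: big_seq1. Qed.

Lemma weightB l j : \sum_(j' <- l) (p j' - p j) = weight l - p j *+ size l.
Proof.
rewrite /weight; elim: l => [|j' l IH]; first by rewrite !big_nil mulr0n subr0.
by rewrite !big_cons IH /= mulrS opprD addrACA.
Qed.

Lemma binomialZ a w : binomial w -> binomial (a *: w).
Proof. by move=> h l l' sl wl; rewrite !seq_valZ sl (h l l'). Qed.

Lemma loc_fracZ a w m x : a != 0 -> loc_frac w m x -> loc_frac (a *: w) m x.
Proof.
move=> a0 [l [l' [sl nz -> ->]]]; exists l, l'; split=> //.
  by rewrite seq_valZ mulf_neq0 ?expf_neq0.
by rewrite !seq_valZ sl -mulf_div divff ?mul1r // expf_neq0.
Qed.

(** Cross-multiplying two fractions for the same [m] gives monomials of equal degree and weight, to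
    which [binomial] applies. *)
Lemma loc_frac_uniq w m x y : binomial w -> loc_frac w m x -> loc_frac w m y -> x = y.
Proof.
move=> bw [l1 [l1' [s1 n1 e1 ->]]] [l2 [l2' [s2 n2 e2 ->]]].
apply/eqP; rewrite eqr_div // -!seq_val_cat; apply/eqP; apply: bw.
  by rewrite !size_cat s1 s2 addnC.
have -> : weight (l1 ++ l2') = m + weight l1' + weight l2' by rewrite weight_cat e1 subrK.
have -> : weight (l2 ++ l1') = m + weight l2' + weight l1' by rewrite weight_cat e2 subrK.
exact: addrAC.
Qed.

Lemma loc_valE w m x : binomial w -> loc_frac w m x -> loc_val w m = x.
Proof. by move=> bw h; apply: xget_unique => // y hy; exact: loc_frac_uniq bw hy h. Qed.

Lemma loc_valP w m : loc w m -> loc_frac w m (loc_val w m).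
Proof. by move=> [x h]; exact: (xgetPex 0 (ex_intro _ x h)). Qed.

Lemma loc_frac0 w : loc_frac w 0 1.
Proof.
by exists [::], [::]; rewrite /seq_val !big_nil divff ?oner_eq0 // subrr.
Qed.

Lemma loc_fracD w m m' x x' :
  loc_frac w m x -> loc_frac w m' x' -> loc_frac w (m + m') (x * x').
Proof.
move=> [l1 [l1' [s1 n1 -> ->]]] [l2 [l2' [s2 n2 -> ->]]].
exists (l1 ++ l2), (l1' ++ l2'); split.
- by rewrite !size_cat s1 s2.
- by rewrite seq_val_cat mulf_neq0.
- by rewrite !weight_cat opprD addrACA.
- by rewrite !seq_val_cat mulf_div.
Qed.

Lemma loc0 w : loc w 0.
Proof. by exists 1; exact: loc_frac0. Qed.

Lemma locD w m m' : loc w m -> loc w m' -> loc w (m + m').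
Proof. by move=> [x h] [x' h']; exists (x * x'); exact: loc_fracD. Qed.

Lemma loc_val0 w : binomial w -> loc_val w 0 = 1.
Proof. by move=> bw; apply: loc_valE => //; exact: loc_frac0. Qed.

Lemma loc_valD w m m' : binomial w -> loc w m -> loc w m' ->
  loc_val w (m + m') = loc_val w m * loc_val w m'.
Proof. by move=> bw h h'; apply: loc_valE => //; apply: loc_fracD; exact: loc_valP. Qed.

Lemma loc_frac_coord w j j' : w 0 j != 0 -> loc_frac w (p j' - p j) (w 0 j' / w 0 j).
Proof.
by move=> wj; exists [:: j'], [:: j]; rewrite !weight1 !seq_val1.
Qed.

Definition toric_proj : set (proj_space C n) :=
  [set z | forall v, coords z v -> binomial v].

Lemma toric_proj_closed : proj_closed toric_proj.
Proof.
exists [set F | exists l l', [/\ size l = size l', weight l = weight l'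
  & F = seq_monomial C l - seq_monomial C l']].
  move=> _ [l [l' [sl _ ->]]]; exists (size l); apply: rpredB; first exact: seq_monomial_homog.
  by rewrite sl; exact: seq_monomial_homog.
have e l l' v : peval (seq_monomial C l - seq_monomial C l') v = seq_val v l - seq_val v l'.
  by rewrite -!peval_seq_monomial /peval mevalB.
apply/seteqP; split=> z h.
  by move=> _ v [l [l' [sl wl ->]]] zv; rewrite e (h _ zv l l') // subrr.
move=> v zv l l' sl wl; apply/eqP; rewrite -subr_eq0 -e; apply/eqP; apply: h => //.
by exists l, l'.
Qed.

Lemma toric_projP z v : coords z v -> toric_proj z <-> binomial v.
Proof.
move=> zv; split=> [|bv v' /(coordsP zv)[a _ ->]]; [exact|exact: binomialZ].
Qed.

End Localization.

(** * The projective embedding *)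

(* What the embedding needs to know of a fan [Sigma] and of a family [p] of
   exponents: [c x], for [x] in [G], are the maximal cones, and [p (k x)] is the
   vertex of the polytope at the cone [c x]. *)
Record polarization (R : realType) (r n : nat) (M : set 'cV[R]_r)
    (Sigma : set (set 'rV[R]_r)) (G : set 'rV[R]_r) (c : 'rV[R]_r -> set 'rV[R]_r)
    (p : 'I_n.+1 -> 'cV[R]_r) (k : 'rV[R]_r -> 'I_n.+1) : Prop := Polarization {
  pol_fan : forall x, G x -> Sigma (c x);
  pol_vertex : forall x j, G x -> dual_monoid M (c x) (p j - p (k x));
  pol_gen : forall x m, G x -> dual_monoid M (c x) m ->
    exists l : seq 'I_n.+1, m = \sum_(j <- l) (p j - p (k x));
  pol_smooth : forall x, G x -> exists (b : 'I_r -> 'rV[R]_r) (be : 'I_r -> 'cV[R]_r),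
    [/\ forall j, dual_monoid M (c x) (be j),
        forall m j, dual_monoid M (c x) m -> ev m (b j) \is a Num.nat
      & forall m, dual_monoid M (c x) m -> m = \sum_j ev m (b j) *: be j];
  pol_local : forall s, Sigma s -> exists x, [/\ G x, s `<=` c x &
    forall m, dual_monoid M s m -> exists u, [/\ dual_monoid M (c x) u,
      dual_monoid M s (- u) & dual_monoid M (c x) (m + u)]];
  pol_cover : forall D : set 'cV[R]_r, D 0 -> (forall m m', D m -> D m' -> D (m + m')) ->
    (exists j, forall j', D (p j' - p j)) ->
    exists2 x, G x & dual_monoid M (c x) `<=` D;
  pol_separation : forall (D : set 'cV[R]_r) x s t, G x ->
    (forall m m', D m -> D m' -> D (m + m')) -> dual_monoid M (c x) `<=` D ->
    (forall m, D m -> exists u, [/\ dual_monoid M (c x) u, D (- u)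
       & dual_monoid M (c x) (m + u)]) ->
    Sigma s -> Sigma t -> dual_monoid M s `<=` D -> dual_monoid M t `<=` D ->
    dual_monoid M (s `&` t) `<=` D
}.

Section Embedding.
Variables (R : realType) (r n : nat).
Local Notation V := 'rV[R]_r.
Local Notation V' := 'cV[R]_r.
Local Notation C := R[i].
Local Notation PV := 'rV[C]_n.+1.
Variables (M : set V') (Sigma : set (set V)) (G : set V) (c : V -> set V).
Variables (p : 'I_n.+1 -> V') (k : V -> 'I_n.+1).
Hypothesis pol : polarization M Sigma G c p k.
Hypothesis M0 : M 0.
Hypothesis MD : forall m m', M m -> M m' -> M (m + m').
Implicit Types (l : seq 'I_n.+1) (w : PV) (m : V') (x : V) (s t : set V).
Local Notation S := (dual_monoid M).
Local Notation loc := (loc p).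
Local Notation loc_val := (loc_val p).
Local Notation binomial := (binomial p).

Let S0 s : S s 0. Proof. exact: dual_monoid0. Qed.

Let SD s m m' : S s m -> S s m' -> S s (m + m').
Proof. by apply: dual_monoidD. Qed.

Let S_sum s I (l : seq I) (F : I -> V') : (forall i, S s (F i)) -> S s (\sum_(i <- l) F i).
Proof. by move=> h; apply: (@closed_sum _ _ (S s)) => //; exact: SD. Qed.

Let S_natmul s m d : S s m -> S s (m *+ d).
Proof. by move=> Sm; apply: (@closed_natmul _ _ (S s)) => //; exact: SD. Qed.

(* [w] is a vector of homogeneous coordinates of the point [g] of the chart of
   [s]. *)
Definition represents s (g : V' -> C) w : Prop :=
  [/\ w != 0, binomial w, S s `<=` loc w & forall m, S s m -> g m = loc_val w m].

Lemma representsZ s g w a : a != 0 -> represents s g w -> represents s g (a *: w).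
Proof.
move=> a0 [w0 bw sw gw]; have sub m : loc w m -> loc (a *: w) m.
  by move=> [x h]; exists x; exact: loc_fracZ.
split; first by rewrite scaler_eq0 negb_or a0.
- exact: binomialZ.
- by move=> m /sw/sub.
move=> m Sm; rewrite gw //; apply/esym/loc_valE; first exact: binomialZ.
by apply: loc_fracZ => //; apply/loc_valP/sw.
Qed.

(** For a nonzero coordinate [j], both [p j - p (k x)] and its opposite lie in [loc w], so w_(k x) /
    w_j is a unit. *)
Lemma loc_vertex x w : G x -> w != 0 -> binomial w -> S (c x) `<=` loc w -> w 0 (k x) != 0.
Proof.
move=> gx /rV0Pn[j wj] bw sw.
have h1 : loc w (p j - p (k x)) by apply/sw/(pol_vertex pol).
have h2 := loc_frac_coord p (k x) wj.
have := loc_valD bw h1 (ex_intro _ _ h2).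
rewrite (loc_valE bw h2) addrA subrK subrr loc_val0 // => e.
apply/eqP => z; move: e; rewrite z mul0r mulr0 => /eqP; by rewrite oner_eq0.
Qed.

Lemma represents_coord s g w x : G x -> s `<=` c x -> represents s g w ->
  w 0 (k x) != 0 /\ forall j, w 0 j = w 0 (k x) * g (p j - p (k x)).
Proof.
move=> gx sx [w0 bw sw gw].
have wk : w 0 (k x) != 0.
  by apply: loc_vertex => // m /(dual_monoidS sx); exact: sw.
split=> // j; rewrite gw; last by apply: (dual_monoidS sx); exact: (pol_vertex pol).
by rewrite (loc_valE bw (loc_frac_coord p j wk)) mulrC divfK.
Qed.

Lemma represents_uniq s g w w' x : G x -> s `<=` c x ->
  represents s g w -> represents s g w' -> exists2 a, a != 0 & w' = a *: w.
Proof.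
move=> gx sx rw rw'; have [wk wE] := represents_coord gx sx rw.
have [wk' wE'] := represents_coord gx sx rw'.
exists (w' 0 (k x) / w 0 (k x)); first by rewrite mulf_neq0 ?invr_eq0.
apply/rowP => j; by rewrite mxE (wE' j) (wE j) mulrA divfK.
Qed.

(** The generators [p j - p (k x)] of the monoid lie in [loc w], their values being w_j / w_(k
    x). *)
Lemma chart_point x w : G x -> binomial w -> w 0 (k x) != 0 ->
  exists g, monoid_homs (S (c x)) g /\ represents (c x) g w.
Proof.
move=> gx bw wk; have sw : S (c x) `<=` loc w.
  move=> m /(pol_gen pol gx)[l ->]; apply: closed_sum; [exact: loc0|exact: locD|].
  by move=> j _; exists (w 0 j / w 0 (k x)); exact: loc_frac_coord.
exists (fun m => if `[< S (c x) m >] then loc_val w m else 0); split.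
  split=> [|m m' Sm Sm'|m nSm].
  - by rewrite asboolT ?loc_val0 //; exact: S0.
  - by rewrite !asboolT ?loc_valD //; [exact: sw|exact: sw|exact: SD].
  - by rewrite asboolF.
split=> //; last by move=> m Sm; rewrite asboolT.
by apply: contraNneq wk => ->; rewrite mxE.
Qed.

(** With [j] a nonzero coordinate, all [p j' - p j] lie in [loc w], so [pol_cover] finds a maximal
    cone whose monoid lies in [loc w]. *)
Lemma vertex_exists w : w != 0 -> binomial w -> exists2 x, G x & w 0 (k x) != 0.
Proof.
move=> w0 bw; have /rV0Pn[j wj] := w0.
have [|x gx sw] := pol_cover pol (loc0 p w) (@locD _ _ _ p w).
  by exists j => j'; exists (w 0 j' / w 0 j); exact: loc_frac_coord.
by exists x => //; exact: loc_vertex.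
Qed.

Definition good_vertex s x := [/\ G x, s `<=` c x &
  forall m, S s m -> exists u, [/\ S (c x) u, S s (- u) & S (c x) (m + u)]].

Definition embed_base s : V := xget 0 (good_vertex s).

Lemma embed_baseP s : Sigma s -> good_vertex s (embed_base s).
Proof. by move=> /(pol_local pol) h; exact: xgetPex. Qed.

(** The characters [p j] divided by the one at the vertex of a maximal cone containing [s], which
    puts all exponents into the monoid of [s] when [s] is a cone of the fan. *)
Definition embed s (g : V' -> C) : PV := \row_j g (p j - p (k (embed_base s))).

Lemma hom_sum s (g : V' -> C) I (l : seq I) (F : I -> V') : monoid_homs (S s) g ->
  (forall j, S s (F j)) -> g (\sum_(j <- l) F j) = \prod_(j <- l) g (F j).
Proof.
move=> [g1 gM _] SF; elim: l => [|j l IH]; first by rewrite !big_nil.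
by rewrite !big_cons gM ?IH //; apply: S_sum.
Qed.

Lemma hom_natmul s (g : V' -> C) m d : monoid_homs (S s) g -> S s m ->
  g (m *+ d) = g m ^+ d.
Proof.
move=> [g1 gM _] Sm; elim: d => [|d IH]; first by rewrite mulr0n expr0.
by rewrite exprS mulrS -IH gM //; exact: S_natmul.
Qed.

(** By localization m = (m + u) - u with both terms in the monoid of the base cone. Each of them is
    a sum of generators, hence the exponent of a monomial relative to the vertex. *)
Lemma represents_embed s g : Sigma s -> monoid_homs (S s) g -> represents s g (embed s g).
Proof.
move=> Ss hg; have [gx sx loc_s] := embed_baseP Ss.
have [g1 gM g0] := hg; rewrite /embed; set x := embed_base s in gx sx loc_s *.
set w := \row_j _; have Sp j : S s (p j - p (k x)).
  by apply: (dual_monoidS sx); exact: (pol_vertex pol).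
have wl l : seq_val w l = g (weight p l - p (k x) *+ size l).
  rewrite -weightB (hom_sum _ hg) //; apply: eq_bigr => j _; by rewrite mxE.
have bw : binomial w by move=> l l' sl wgt; rewrite !wl sl wgt.
have wk : w 0 (k x) = 1 by rewrite mxE subrr.
have frac m : S s m -> loc_frac p w m (g m).
  move=> Sm; have [u [Su SNu Smu]] := loc_s _ Sm.
  have [l uE] := pol_gen pol gx Su; have [l' muE] := pol_gen pol gx Smu.
  have Su' := dual_monoidS sx Su.
  have gu : g u != 0.
    apply/eqP => z; have := gM _ _ Su' SNu; rewrite subrr g1 z mul0r => /eqP.
    by rewrite oner_eq0.
  have vl i : seq_val w (l ++ nseq i (k x)) = g u.
    by rewrite seq_val_cat seq_val_nseq wk expr1n mulr1 wl -weightB -uE.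
  have vl' i : seq_val w (l' ++ nseq i (k x)) = g (m + u).
    by rewrite seq_val_cat seq_val_nseq wk expr1n mulr1 wl -weightB -muE.
  (* Padding by [k x], where the coordinate is 1, gives both sequences the same length. *)
  exists (l' ++ nseq (size l) (k x)), (l ++ nseq (size l') (k x)); split.
  - by rewrite !size_cat !size_nseq addnC.
  - by rewrite vl.
  - have -> : m = (m + u) - u by rewrite addrK.
    rewrite muE uE !weightB !weight_cat !weight_nseq !opprD !opprK.
    by rewrite addrAC addrA; rewrite -!addrA; congr (_ + _); rewrite addrCA.
  - by rewrite vl vl' gM // mulfK.
split=> //; first by apply/eqP => z; move/eqP: wk; rewrite z mxE eq_sym oner_eq0.
  by move=> m Sm; exists (g m); exact: frac.
by move=> m Sm; rewrite (loc_valE bw (frac _ Sm)).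
Qed.

Local Notation pt := {s : {s | Sigma s} & toric_chart M (sval s)}.
Local Notation cone q := (sval (tag q)).
Local Notation hom q := (sval (tagged q)).

Definition embed_pt (q : pt) : PV := embed (cone q) (hom q).

Lemma embed_ptP (q : pt) : represents (cone q) (hom q) (embed_pt q).
Proof. by apply: represents_embed; [exact: (svalP (tag q))|exact: (svalP (tagged q))]. Qed.

Lemma represents_pt_uniq (q : pt) w w' : represents (cone q) (hom q) w ->
  represents (cone q) (hom q) w' -> exists2 a, a != 0 & w' = a *: w.
Proof.
have [gx sx _] := embed_baseP (svalP (tag q)); exact: represents_uniq gx sx.
Qed.

(** A common extension to the intersection has an invertible value at the difference of the two base
    vertices, which makes the coordinate vectors proportional. Conversely [pol_separation] for
    [loc w] shows that the homomorphism of [w] is defined on the monoid of the intersection. *)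
Lemma gluingP (q q' : pt) :
  toric_gluing q q' <-> represents (cone q') (hom q') (embed_pt q).
Proof.
split=> [[g [g1 gM g0] [gq gq']]|rq'].
  have [gx sx _] := embed_baseP (svalP (tag q)).
  have [gx' sx' _] := embed_baseP (svalP (tag q')).
  move: (embed_ptP q') (embed_ptP q) gx sx gx' sx'.
  set w' := embed_pt q'; set w := embed_pt q.
  set x := embed_base (cone q); set x' := embed_base (cone q').
  move=> rw' rw gx sx gx' sx'.
  have [wk wE] := represents_coord gx sx rw.
  have [wk' wE'] := represents_coord gx' sx' rw'.
  have Sv j : S (cone q) (p j - p (k x)).
    by apply: (dual_monoidS sx); exact: (pol_vertex pol).
  have Sv' j : S (cone q') (p j - p (k x')).
    by apply: (dual_monoidS sx'); exact: (pol_vertex pol).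
  have subl : S (cone q) `<=` S (cone q `&` cone q') by apply: dual_monoidS => ? [].
  have subr : S (cone q') `<=` S (cone q `&` cone q') by apply: dual_monoidS => ? [].
  have e : g (p (k x') - p (k x)) * g (p (k x) - p (k x')) = 1.
    by rewrite -gM ?g1 //; [rewrite addrA subrK subrr|exact: subl|exact: subr].
  have nz : g (p (k x') - p (k x)) != 0.
    by apply/eqP => z; move/eqP: e; rewrite z mul0r eq_sym oner_eq0.
  have -> : w = (w 0 (k x) * g (p (k x') - p (k x)) / w' 0 (k x')) *: w'.
    apply/rowP => j; rewrite [RHS]mxE (wE' j) mulrA divfK // (wE j) gq // gq' //.
    rewrite -mulrA -gM; first by congr (_ * g _); rewrite [RHS]addrC addrA subrK.
      exact: subl.
    exact: subr.
  by apply: representsZ => //; rewrite !mulf_neq0 // invr_eq0.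
have [w0 bw sw gw] := embed_ptP q; have [_ _ sw' gw'] := rq'.
set w := embed_pt q in w0 bw sw gw sw' gw' *.
have [gx sx _] := embed_baseP (svalP (tag q)).
have SI : S (cone q `&` cone q') `<=` loc w.
  apply: (pol_separation pol gx) => //; try exact: svalP.
  - exact: locD.
  - by move=> m /(dual_monoidS sx); exact: sw.
  move=> m [_ [l [l' [sl nz mE _]]]].
  set x := embed_base _ in gx sx *.
  have wk : w 0 (k x) != 0 by case: (represents_coord gx sx (embed_ptP q)).
  have Sw l0 : S (c x) (weight p l0 - p (k x) *+ size l0).
    by rewrite -weightB; apply: S_sum => j; exact: (pol_vertex pol).
  (* This clears the denominator [l'] of [m]: [- u] is a fraction with this denominator, and [m + u]
     is the exponent of the numerator [l] relative to the vertex. *)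
  exists (weight p l' - p (k x) *+ size l'); split=> //.
    exists (seq_val w (nseq (size l') (k x)) / seq_val w l').
    exists (nseq (size l') (k x)), l'; rewrite size_nseq weight_nseq opprB; split=> //.
  by rewrite mE addrA subrK -sl.
exists (fun m => if `[< S (cone q `&` cone q') m >] then loc_val w m else 0).
  split=> [|m m' Sm Sm'|m nSm].
  - by rewrite asboolT ?loc_val0 //; exact: S0.
  - by rewrite !asboolT ?loc_valD //; [exact: SI|exact: SI|exact: SD].
  - by rewrite asboolF.
split=> m Sm; rewrite asboolT.
- exact: gw.
- by apply: dual_monoidS Sm => ? [].
- exact: gw'.
- by apply: dual_monoidS Sm => ? [].
Qed.

Local Notation X := (glue (@toric_gluing R r M Sigma)).
Local Notation incl i := (@glue_incl C {s | Sigma s}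
  (fun j : {s | Sigma s} => toric_chart M (sval j)) (@toric_gluing R r M Sigma) i).
Local Notation Z := (toric_proj p).
Local Notation Zspace := (@proj_fspace C n Z).

Lemma embed_pt_neq0 (q : pt) : embed_pt q != 0.
Proof. by case: (embed_ptP q). Qed.

Lemma embed_pt_toric (q : pt) : Z (proj_point (embed_pt_neq0 q)).
Proof.
apply/(toric_projP _ (coords_proj_point (embed_pt_neq0 q))).
by case: (embed_ptP q).
Qed.

Definition embed_proj (q : pt) : Zspace :=
  exist Z (proj_point (embed_pt_neq0 q)) (@embed_pt_toric q).

Lemma embed_proj_coords (q : pt) w :
  coords (sval (embed_proj q)) w <-> represents (cone q) (hom q) w.
Proof.
have h := coords_proj_point (embed_pt_neq0 q); split=> [/(coordsP h)[a a0 ->]|rw].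
  exact/representsZ/embed_ptP.
by apply/(coordsP h); apply: represents_pt_uniq rw; exact: embed_ptP.
Qed.

Lemma sig_eq (T : Type) (P : T -> Prop) (a b : {z | P z}) : sval a = sval b -> a = b.
Proof. by case: a b => [a pa] [b pb] /= e; exact: eq_exist. Qed.

Lemma embed_proj_eq (q q' : pt) w : represents (cone q) (hom q) w ->
  represents (cone q') (hom q') w -> embed_proj q = embed_proj q'.
Proof.
move=> /embed_proj_coords h /embed_proj_coords h'.
by apply: sig_eq; exact: coords_inj h h'.
Qed.

Definition embedding (y : X) : Zspace := embed_proj (projT1 (cid (svalP y))).

(** The representative chosen in [embedding] may lie in another chart, but by [gluingP] it has the
    same coordinates. *)
Lemma embeddingE (i : {s | Sigma s}) (g : toric_chart M (sval i)) :
  embedding (incl i g) = embed_proj (existT _ i g).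
Proof.
rewrite /embedding; case: cid => q' /= e.
have : toric_gluing q' q' by apply/gluingP/embed_ptP.
rewrite -e => /gluingP h; apply: esym; apply: embed_proj_eq h.
exact: embed_ptP.
Qed.

Lemma embedding_inj : injective embedding.
Proof.
move=> y y'; rewrite /embedding; case: cid => q e; case: cid => q' e' /= qq'.
apply: sig_eq; rewrite e e'.
have : coords (sval (embed_proj q')) (embed_pt q).
  by rewrite -qq'; apply/embed_proj_coords/embed_ptP.
move=> /embed_proj_coords h.
have [a a0 aE] := represents_pt_uniq h (embed_ptP q').
have [b b0 bE] := represents_pt_uniq (embed_ptP q') h.
apply/seteqP; split=> z /gluingP hz; apply/gluingP.
  by rewrite aE; exact: representsZ.
by rewrite bE; exact: representsZ.
Qed.

Lemma embedding_chart x v (gx : G x) (z : Zspace) : coords (sval z) v -> v 0 (k x) != 0 ->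
  exists g : toric_chart M (c x), represents (c x) (sval g) v /\
    embedding (incl (exist _ (c x) (pol_fan pol gx)) g) = z.
Proof.
move=> zv vk; have bv : binomial v by exact/(toric_projP _ zv)/(svalP z).
have [g [hg rg]] := chart_point gx bv vk.
exists (exist _ g hg); split=> //; rewrite embeddingE; apply: sig_eq.
by apply: coords_inj zv; apply/embed_proj_coords.
Qed.

Lemma toric_vertex (z : Zspace) v : coords (sval z) v -> exists2 x, G x & v 0 (k x) != 0.
Proof.
move=> zv; apply: vertex_exists; first by case: zv.
exact/(toric_projP _ zv)/(svalP z).
Qed.

Lemma embedding_surj (z : Zspace) : exists y, embedding y = z.
Proof.
have [v zv] := coords_exists (sval z); have [x gx vk] := toric_vertex zv.
by have [g [_ <-]] := embedding_chart gx zv vk; eexists.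
Qed.

Definition embedding_inv (z : Zspace) : X := projT1 (cid (embedding_surj z)).

Lemma embedding_invK : cancel embedding_inv embedding.
Proof. by move=> z; rewrite /embedding_inv; case: cid. Qed.

Lemma embeddingK : cancel embedding embedding_inv.
Proof. by move=> y; apply: embedding_inj; rewrite embedding_invK. Qed.

Lemma embedding_invE y z : embedding y = z -> embedding_inv z = y.
Proof. by move=> <-; rewrite embeddingK. Qed.

Lemma peval_embed_algebra s F : Sigma s -> semigroup_algebra (S := S s)
  (fun g : {g | monoid_homs (S s) g} => peval F (embed s (sval g))).
Proof.
move=> Ss; have [gx sx _] := embed_baseP Ss.
have Sp j : S s (p j - p (k (embed_base s))).
  by apply: (dual_monoidS sx); exact: (pol_vertex pol).
exists [seq (F@_m, \sum_j (p j - p (k (embed_base s))) *+ m j) | m : 'X_{1..n.+1} <- msupp F].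
  by move=> _ /mapP[m _ ->] /=; apply: S_sum => j; exact: S_natmul.
move=> [g hg] /=; rewrite /peval mevalE big_map; apply: eq_bigr => m _ /=; congr (_ * _).
rewrite -[in RHS]big_enum (hom_sum _ hg).
  by rewrite big_enum /=; apply: eq_bigr => j _; rewrite mxE -(hom_natmul _ hg).
by move=> j; exact: S_natmul.
Qed.

Lemma represents_seq_val s g w x l : G x -> s `<=` c x -> monoid_homs (S s) g ->
  represents s g w ->
  seq_val w l = w 0 (k x) ^+ size l * g (\sum_(j <- l) (p j - p (k x))).
Proof.
move=> gx sx hg rw; have [wk wE] := represents_coord gx sx rw.
rewrite (hom_sum _ hg); last first.
  by move=> j; apply: (dual_monoidS sx); exact: (pol_vertex pol).
rewrite /seq_val; elim: l => [|j l IH]; first by rewrite !big_nil expr0 mulr1.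
by rewrite !big_cons IH (wE j) /= exprS mulrACA.
Qed.

(** Characters on a maximal chart are products of fractions w_j / w_(k x); powers of the coordinate
    at [k x] clear the denominators. *)
Lemma homogenize x (h : {g | monoid_homs (S (c x)) g} -> C) : G x ->
  semigroup_algebra h -> exists d F, F \is d.-homog /\
  forall (g : {g | monoid_homs (S (c x)) g}) w, represents (c x) (sval g) w ->
    peval F w = h g * w 0 (k x) ^+ d.
Proof.
move=> gx [cs csS hE].
suff [d [F [hF FE]]] : exists d F, F \is d.-homog /\ forall g w,
    monoid_homs (S (c x)) g -> represents (c x) g w ->
    peval F w = (\sum_(t <- cs) t.1 * g t.2) * w 0 (k x) ^+ d.
  by exists d, F; split=> // -[g hg] w rw; rewrite hE (FE g).
elim: cs csS {hE} => [|t cs IH] csS.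
  exists 0%N, 0; split; first exact: dhomog0.
  by move=> g w _ _; rewrite big_nil mul0r /peval meval0.
have [t' t'cs|d [F [hF FE]]] := IH; first by apply: csS; rewrite inE t'cs orbT.
have /(pol_gen pol gx)[l tE] := csS t (mem_head _ _).
exists (size l + d)%N, (t.1 *: (seq_monomial C l * 'X_(k x) ^+ d) + F * 'X_(k x) ^+ size l).
split.
  apply: dhomogD; first exact/dhomogZ/dhomogM/Xexp_homog/seq_monomial_homog.
  by rewrite addnC; apply/dhomogM/Xexp_homog.
move=> g w hg rw; rewrite big_cons {1}/peval mevalD mevalZ -!/(peval _ _).
rewrite !pevalM !peval_exp !pevalX peval_seq_monomial (FE g w hg rw).
rewrite (represents_seq_val l gx _ hg rw) // -tE exprD.
ring.
Qed.

Lemma embedding_morphism : is_morphism embedding.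
Proof.
move=> W [Y [SY hSY YE] ->].
(* By homogeneity, vanishing need only be tested on the coordinate vector given by [embed]. *)
have pre (i : {s | Sigma s}) (g : toric_chart M (sval i)) : ~ Y (sval (embedding (incl i g))) <->
    exists2 F, SY F & peval F (embed (sval i) (sval g)) != 0.
  rewrite embeddingE YE /=; set z := proj_point _.
  have zv : coords z (embed (sval i) (sval g)) by apply: coords_proj_point.
  split=> [h|[F SF /eqP nz] h]; last by apply: nz; exact: h.
  apply: contrapT => h'; apply: h => F v SF /(coordsP zv)[a a0 ->].
  have [d hF] := hSY _ SF; rewrite (pevalZ _ _ hF).
  have [->|/eqP nz] := pselect (peval F (embed (sval i) (sval g)) = 0); first by rewrite mulr0.
  by exfalso; apply: h'; exists F.
split.
  move=> i; exists [set h | exists2 F, SY F &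
      h = fun g : toric_chart M (sval i) => peval F (embed (sval i) (sval g))].
    by move=> _ [F _ ->]; apply: peval_embed_algebra; exact: svalP.
  apply/seteqP; split=> g /=.
    move=> /pre[F SF nz].
    exists (fun g : toric_chart M (sval i) => peval F (embed (sval i) (sval g))) => //.
    by exists F.
  by move=> [_ [F SF ->] nz]; apply/pre; exists F.
move=> f reg i g Wg; have [d [F1 [F2 [h1 h2 nz fE]]]] := reg (embedding (incl i g)) Wg.
exists (fun g : toric_chart M (sval i) => peval F1 (embed (sval i) (sval g))).
exists (fun g : toric_chart M (sval i) => peval F2 (embed (sval i) (sval g))).
have co (g' : toric_chart M (sval i)) :
    coords (sval (embedding (incl i g'))) (embed (sval i) (sval g')).
  by rewrite embeddingE; apply: coords_proj_point.
split; try (apply: peval_embed_algebra; exact: svalP).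
- exact: nz.
- by move=> g' Wg' nz'; apply: fE.
Qed.

Lemma embedding_inv_morphism : is_morphism embedding_inv.
Proof.
move=> W oW.
have chart (z : Zspace) v x (gx : G x) : coords (sval z) v -> v 0 (k x) != 0 ->
    exists g : toric_chart M (c x), represents (c x) (sval g) v /\
      embedding_inv z = incl (exist _ (c x) (pol_fan pol gx)) g.
  move=> zv vk; have [g [rg gz]] := embedding_chart gx zv vk.
  by exists g; split=> //; exact: embedding_invE.
(* Equations for the complement of [W]: homogenized functions whose nonvanishing loci lie in [W].
   The factor ['X_(k x)] makes them vanish outside the chart of [x]. *)
pose SY := [set F' : {mpoly C[n.+1]} | exists x (gx : G x) h d F,
  [/\ @semigroup_algebra R r (S (c x)) h, F \is d.-homog,
      forall (g : {g | monoid_homs (S (c x)) g}) w, represents (c x) (sval g) w ->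
        peval F w = h g * w 0 (k x) ^+ d,
      (forall g, h g != 0 -> W (incl (exist _ (c x) (pol_fan pol gx)) g))
    & F' = 'X_(k x) * F]].
split.
  exists [set z | forall F v, SY F -> coords z v -> peval F v = 0].
    exists SY => // _ [x [gx [h [d [F [_ hF _ _ ->]]]]]]; exists (1 + d)%N.
    by apply: dhomogM; first exact: X_homog.
  apply/seteqP; split=> z /=.
    move=> Wz hz; have [v zv] := coords_exists (sval z).
    have [x gx vk] := toric_vertex zv; have [g [rg gz]] := chart _ _ _ gx zv vk.
    have [Sh hSh WE] := oW (exist _ (c x) (pol_fan pol gx)).
    have : (incl (exist _ (c x) (pol_fan pol gx)) @^-1` W) g by rewrite /= -gz.
    rewrite WE => -[h Shh hg].
    have [d [F [hF FE]]] := homogenize gx (hSh _ Shh).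
    have : peval ('X_(k x) * F) v = 0.
      apply: hz => //; exists x, gx, h, d, F; split=> //; first exact: hSh.
      move=> g' hg'; suff : (incl (exist _ (c x) (pol_fan pol gx)) @^-1` W) g' by [].
      by rewrite WE; exists h.
    apply/eqP; rewrite pevalM pevalX (FE _ _ rg) !mulf_neq0 // expf_neq0 //.
  move=> hz; apply: contrapT => nW; apply: hz => _ v [x [gx [h [d [F [_ _ FE hW ->]]]]]] zv.
  rewrite pevalM pevalX; have [->|vk] := eqVneq (v 0 (k x)) 0; first by rewrite mul0r.
  have [g [rg gz]] := chart _ _ _ gx zv vk; rewrite (FE _ _ rg).
  have [->|nz] := eqVneq (h g) 0; first by rewrite mul0r mulr0.
  by case: nW; rewrite gz; exact: hW.
move=> f reg z Wz; have [v zv] := coords_exists (sval z).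
have [x gx vk] := toric_vertex zv; have [g [rg gz]] := chart _ _ _ gx zv vk.
rewrite /= gz in Wz; have [h1 [h2 [a1 a2 nz fE]]] := reg _ _ Wz.
have [d1 [F1 [hF1 F1E]]] := homogenize gx a1.
have [d2 [F2 [hF2 F2E]]] := homogenize gx a2.
(* The two homogenized functions are brought to the common degree [d2.+1 + d1]; the additional
   factor ['X_(k x)] confines the nonzero values of the denominator to the chart of [x]. *)
exists (d2.+1 + d1)%N, ('X_(k x) ^+ d2.+1 * F1), ('X_(k x) ^+ d1.+1 * F2); split.
- by apply: dhomogM => //; exact: Xexp_homog.
- by rewrite addSnnS addnC; apply: dhomogM => //; exact: Xexp_homog.
- move=> v' /(coordsP zv)[a a0 ->].
  have ak : (a *: v) 0 (k x) != 0 by rewrite mxE mulf_neq0.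
  rewrite pevalM peval_exp pevalX (F2E g); last exact: representsZ.
  by rewrite !mulf_neq0 // expf_neq0.
move=> z' v' Wz' z'v'; rewrite !pevalM !peval_exp !pevalX.
have [->|vk'] := eqVneq (v' 0 (k x)) 0; first by rewrite exprS !mul0r eqxx.
have [g' [rg' gz']] := chart _ _ _ gx z'v' vk'.
rewrite (F1E _ _ rg') (F2E _ _ rg') => nz'.
have h2g' : h2 g' != 0 by move: nz'; rewrite !mulf_eq0 !negb_or => /andP[_ /andP[]].
have -> : (f \o embedding_inv) z' = h1 g' / h2 g'.
  rewrite /= gz'; apply: (fE g') => //.
  by rewrite /= -gz'.
have nk i : v' 0 (k x) ^+ i != 0 by rewrite expf_neq0.
rewrite !exprS; field.
by rewrite h2g' !nk vk'.
Qed.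

Lemma embedding_isomorphic : isomorphic X Zspace.
Proof.
exists embedding, embedding_inv; split.
- exact: embedding_morphism.
- exact: embedding_inv_morphism.
- exact: embeddingK.
- exact: embedding_invK.
Qed.

End Embedding.

(** * Irreducibility of the image *)

Section Irreducible.
Variables (R : realType) (r n : nat).
Local Notation V := 'rV[R]_r.
Local Notation V' := 'cV[R]_r.
Local Notation C := R[i].
Local Notation PV := 'rV[C]_n.+1.
Variables (M : set V') (Sigma : set (set V)) (G : set V) (c : V -> set V).
Variables (p : 'I_n.+1 -> V') (k : V -> 'I_n.+1).
Hypothesis pol : polarization M Sigma G c p k.
Hypothesis M0 : M 0.
Hypothesis MD : forall m m', M m -> M m' -> M (m + m').
Implicit Types (w : PV) (x : V) (F : {mpoly C[n.+1]}).
Local Notation S := (dual_monoid M).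
Local Notation binomial := (binomial p).
Local Notation Z := (@toric_proj R r n p).

Definition monomial_map (e : 'I_n.+1 -> 'I_r -> nat) (z : 'I_r -> C) : PV :=
  \row_j \prod_i z i ^+ e j i.

(** The parameters z_i are the values at the basis [be] of the monoid, and [e j] lists the natural
    coordinates of [p j - p (k x)]. *)
Lemma chart_param x : G x -> exists e : 'I_n.+1 -> 'I_r -> nat,
  (forall z, monomial_map e z != 0 /\ binomial (monomial_map e z)) /\
  forall w, binomial w -> w 0 (k x) != 0 ->
    exists z a, a != 0 /\ w = a *: monomial_map e z.
Proof.
move=> gx; have [b [be [Sbe bN bE]]] := pol_smooth pol gx.
pose crd m i := Num.truncn (ev m (b i)).
have crdE m i : S (c x) m -> (crd m i)%:R = ev m (b i) 
  by move=> Sm; rewrite /crd truncnK // bN.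
have Sp j : S (c x) (p j - p (k x)) by exact: (pol_vertex pol).
exists (fun j i => crd (p j - p (k x)) i); split=> [z|w bw wk].
  have SDx m m' : S (c x) m -> S (c x) m' -> S (c x) (m + m') by exact: dual_monoidD.
  have sub l : S (c x) (\sum_(j <- l) (p j - p (k x))).
    by apply: (@closed_sum _ _ (S (c x))) => //; exact: dual_monoid0.
  have wE l : seq_val (monomial_map (fun j i => crd (p j - p (k x)) i) z) l =
      \prod_i z i ^+ crd (weight p l - p (k x) *+ size l) i.
    rewrite -weightB /seq_val; elim: l => [|j l IH].
      by rewrite !big_nil big1 // => i _; rewrite /crd ev0l truncn0 expr0.
    rewrite !big_cons IH mxE -big_split /=; apply: eq_bigr => i _; rewrite -exprD.
    congr (_ ^+ _); apply/eqP; rewrite -(eqr_nat R) natrD (crdE _ _ (Sp j)).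
    by rewrite (crdE _ _ (sub l)) (crdE _ _ (SDx _ _ (Sp j) (sub l))) -evDl.
  split; last by move=> l l' sl wl; rewrite !wE sl wl.
  apply/eqP => /rowP/(_ (k x)); rewrite !mxE big1 => [/eqP|i _]; first by rewrite oner_eq0.
  by rewrite subrr /crd ev0l truncn0 expr0.
have [g [hg rg]] := chart_point pol M0 MD gx bw wk.
have [_ wg] := represents_coord pol gx (@subset_refl _ _) rg.
exists (fun i => g (be i)), (w 0 (k x)); split=> //; apply/rowP => j.
rewrite !mxE (wg j) {1}(bE _ (Sp j)); congr (_ * _).
rewrite (eq_bigr (fun i => be i *+ crd (p j - p (k x)) i)); last first.
  by move=> i _; rewrite -crdE // scaler_nat.
rewrite -big_enum (hom_sum M0 MD _ hg); last first.
  move=> i; apply: (@closed_natmul _ _ (S (c x))) => //; first exact: dual_monoid0.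
  by move=> m m'; exact: dual_monoidD.
by rewrite big_enum; apply: eq_bigr => i _; rewrite (hom_natmul M0 MD _ hg).
Qed.

(** On the line through [z1] and [z2] both polynomials restrict to nonzero polynomials in one
    variable, whose product has a nonroot. *)
Lemma monomial_map_join e (z1 z2 : 'I_r -> C) F1 F2 :
  peval F1 (monomial_map e z1) != 0 -> peval F2 (monomial_map e z2) != 0 ->
  exists z, peval F1 (monomial_map e z) != 0 /\ peval F2 (monomial_map e z) != 0.
Proof.
move=> n1 n2; pose q j := \prod_i ((z1 i)%:P + (z2 i - z1 i)%:P * 'X) ^+ e j i.
pose z t i := z1 i + (z2 i - z1 i) * t.
have qE t : \row_j (q j).[t] = monomial_map e (z t).
  apply/rowP => j; rewrite !mxE horner_prod; apply: eq_bigr => i _.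
  by rewrite horner_exp !hornerE.
have [Q1 Q1E] := peval_poly F1 q; have [Q2 Q2E] := peval_poly F2 q.
have z0 : z 0 = z1 by apply/funext => i; rewrite /z mulr0 addr0.
have z_1 : z 1 = z2 by apply/funext => i; rewrite /z mulr1 addrC subrK.
have [|t] := @poly_nonroot _ (Q1 * Q2).
  rewrite mulf_neq0 //; apply/eqP => Q0.
    by move: n1; rewrite -z0 -qE -Q1E Q0 horner0 eqxx.
  by move: n2; rewrite -z_1 -qE -Q2E Q0 horner0 eqxx.
rewrite hornerM mulf_eq0 negb_or Q1E Q2E qE => /andP[h1 h2].
by exists (z t).
Qed.

Lemma peval_scale_neq0 F d w a : F \is d.-homog -> a != 0 ->
  (peval F (a *: w) != 0) = (peval F w != 0).
Proof. by move=> hF a0; rewrite (pevalZ _ _ hF) mulf_eq0 expf_eq0 (negPf a0) andbF. Qed.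

(** In a chart containing [w], the point is joined with the one whose parameters are all 1, where
    the product of all coordinates is nonzero. *)
Lemma torus_dense F d w : F \is d.-homog -> w != 0 -> binomial w -> peval F w != 0 ->
  exists w', [/\ w' != 0, binomial w', forall j, w' 0 j != 0 & peval F w' != 0].
Proof.
move=> hF w0 bw nz; have [x gx wk] := vertex_exists pol w0 bw.
have [e [eb ew]] := chart_param gx.
have [z [a [a0 wE]]] := ew _ bw wk; rewrite wE (peval_scale_neq0 _ hF a0) in nz.
have n1 : peval (\prod_j 'X_j) (monomial_map e (fun=> 1)) != 0.
  rewrite peval_prod; apply/prodf_neq0 => j _.
  by rewrite mxE big1 ?oner_eq0 // => i _; rewrite expr1n.
have [z' [F' T']] := monomial_map_join nz n1.
exists (monomial_map e z'); have [? ?] := eb z'; split=> // j.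
by move: T'; rewrite peval_prod => /prodf_neq0/(_ j isT).
Qed.

(** By [torus_dense], witnesses against both closed sets can be taken with all coordinates nonzero.
    They then lie in the same chart and can be joined there. *)
Lemma toric_proj_irreducible : proj_irreducible Z.
Proof.
have [//|//||x gx _] := pol_cover pol (D := setT); first by exists 0.
have [e [eb _]] := chart_param gx.
split.
  have [w0 bw] := eb (fun=> 1).
  by exists (proj_point w0); apply/(toric_projP _ (coords_proj_point w0)).
move=> Z1 Z2 [S1 hS1 Z1E] [S2 hS2 Z2E] ZZ.
apply: contrapT => /not_orP[/existsNP[z1 /not_implyP[Zz1 nz1]]].
move=> /existsNP[z2 /not_implyP[Zz2 nz2]].
have wit (S' : set {mpoly C[n.+1]}) z : (forall F, S' F -> exists d, F \is d.-homog) -> Z z ->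
    ~ (forall F v, S' F -> coords z v -> peval F v = 0) ->
    exists F d w, [/\ S' F, F \is d.-homog & [/\ binomial w, forall j, w 0 j != 0
       & peval F w != 0]].
  move=> hS' Zz /existsNP[F /existsNP[v /not_implyP[S'F /not_implyP[zv /eqP nz]]]].
  have [d hF] := hS' _ S'F; have [v0 _] := zv.
  have bv : binomial v by exact/(toric_projP _ zv).
  by have [w [_ bw wj Fw]] := torus_dense hF v0 bv nz; exists F, d, w.
rewrite Z1E in nz1; rewrite Z2E in nz2.
have [F1 [d1 [w1 [S1F1 h1 [b1 t1 n1]]]]] := wit _ _ hS1 Zz1 nz1.
have [F2 [d2 [w2 [S2F2 h2 [b2 t2 n2]]]]] := wit _ _ hS2 Zz2 nz2.
have {eb}[e' [eb ew]] := chart_param gx.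
have [z [a [a0 E1]]] := ew _ b1 (t1 _); have [z' [a' [a0' E2]]] := ew _ b2 (t2 _).
rewrite E1 (peval_scale_neq0 _ h1 a0) in n1; rewrite E2 (peval_scale_neq0 _ h2 a0') in n2.
have [y [y1 y2]] := monomial_map_join n1 n2; have [w0 bw] := eb y.
have zc := coords_proj_point w0.
have [] := ZZ (proj_point w0); first exact/(toric_projP _ zc).
- by rewrite Z1E => /(_ _ _ S1F1 zc)/eqP; rewrite (negPf y1).
- by rewrite Z2E => /(_ _ _ S2F2 zc)/eqP; rewrite (negPf y2).
Qed.

End Irreducible.

(** * The polarization given by sums of roots *)

Lemma arrangement_polarization (R : realType) (r : nat) (A : set (set 'rV[R]_r))
    (Phi : set 'cV[R]_r) : crystallographic_arrangement A Phi ->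
  exists n (p : 'I_n.+1 -> 'cV[R]_r) k,
    polarization (int_span Phi) (arrangement_fan A) (generic Phi) (ccell Phi) p k.
Proof.
move=> hA; have [n [p [pc cp]]] := subset_sums Phi.
have /choice[k kE] : forall x : 'rV[R]_r, exists j,
    p j = \sum_(a <- roots Phi | ev a x < 0) a by move=> x; exact: cp.
have S0 s : dual_monoid (int_span Phi) s 0 by apply: dual_monoid0; exact: int_span0 hA.
exists n, p, k; split.
- by move=> x; exact: ccell_fan.
- by move=> x j gx; have [c ->] := pc j; rewrite kE; exact: (subset_sum_min hA).
- move=> x m gx Sm; have [b [be hb]] := chamber_basis_exists hA gx.
  pose D : set 'cV[R]_r := [set m | exists l : seq 'I_n.+1, m = \sum_(j <- l) (p j - p (k x))].
  suff : D m by []; apply: (dual_ccell_span hA gx hb) Sm.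
  + by exists [::]; rewrite big_nil.
  + by move=> _ _ [l ->] [l' ->]; exists (l ++ l'); rewrite big_cat.
  (* [be i] is positive, hence not in the vertex sum; adding it there gives [be i] as a difference
     of exponents. *)
  + move=> i; have [j jE] := cp (fun a => (ev a x < 0) || (a == be i)).
    exists [:: j]; rewrite big_seq1 jE kE (sum_insert hA) //.
    * by rewrite addrC addKr.
    * exact: (basis_root hb).
    * by rewrite -leNgt ltW // (basis_gt0 hb).
- move=> x gx; have [b [be hb]] := chamber_basis_exists hA gx; exists b, be; split.
  + by move=> j; exact: (dual_ccell_root hA gx (basis_root hb j) (basis_gt0 hb j)).
  + by move=> m j /(dual_ccellP hA _ gx hb).
  + by move=> m _; exact: (basis_suml hb).
- by move=> s; exact: fan_localization.
(* Dropping [a] from the subset of [p j], or adding it, changes the sum by [- a] or [a]. *)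
- move=> D D0 DD [j Dj]; apply: (parabolic_chamber hA D0 DD) => a Pa.
  have [c jE] := pc j; have [ca|nca] := boolP (c a).
    have [j' j'E] := cp (fun a' => c a' && (a' != a)); right.
    suff <- : p j' - p j = - a by exact: Dj.
    have -> : p j = p j' + a; last by rewrite opprD addrA subrr sub0r.
    rewrite jE j'E -(sum_insert hA) ?eqxx ?andbF //; apply: eq_bigl => a'.
    by have [->|] := eqVneq a' a; rewrite ?ca ?andbT ?orbF.
  have [j' j'E] := cp (fun a' => c a' || (a' == a)); left.
  suff <- : p j' - p j = a by exact: Dj.
  by rewrite jE j'E (sum_insert hA) // addrC addKr.
- by move=> D x s t; exact: fan_separation.
Qed.

Theorem corollary5p3 (R : realType) (r : nat)
    (A : set (set 'rV[R]_r)) (Phi : set 'cV[R]_r)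
    (hA : crystallographic_arrangement A Phi) :
  let M := int_span Phi in
  let N := dual_lattice M in
  let Sigma := arrangement_fan A in
  let vert := [set rho Phi K | K in chambers A] in
  let P := convex_hull vert in
  [/\ vertices P = vert,
      projective_variety (toric_variety N Sigma)
    & isomorphic (toric_variety N Sigma) (toric_variety N (normal_fan P))].
Proof.
move=> M N Sigma vert P; split; first exact: vertices_hull.
  have [n [p [k pol]]] := arrangement_polarization hA.
  have M0 := int_span0 hA; have MD := int_spanD hA.
  exists n, (toric_proj p); split.
  - exact: toric_proj_closed.
  - exact: (toric_proj_irreducible pol M0 MD).
  (* The variety is built from the characters of [N], and these are [M] again. *)
  rewrite /toric_variety /N (character_latticeK hA).
  exact: (embedding_isomorphic pol M0 MD).
rewrite /P (normal_fan_hull hA).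
by exists id, id; split => // W oW; split.
Qed.
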